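(* Let $(W,S)$ be a Coxeter system with $S$ finite, and let $S=R\sqcup B$ be a right-angled partition. Let $w$ be a cyclic loop on the alphabet $S$ such that $l_R(w)<\gamma(W_R)$ and $l_B(w)<\gamma(W_B)$. Then the loop $|w|$ is null-homotopic in $\mathrm{Cay}^+W$.
   Context: $(W,S)$ has Coxeter matrix $(m_{s,t})_{s,t\in S}$ with $m_{s,t}\in\mathbb Z_{\ge2}\cup\{\infty\}$ for $s\ne t$. A partition $S=R\sqcup B$ is right-angled if $m_{s,t}\in\{2,\infty\}$ for all $s\in R$, $t\in B$. For $I\subset S$, $W_I$ is the subgroup generated by $I$; $(W_I,I)$ is a Coxeter system with matrix $(m_{s,t})_{s,t\in I}$. The girth of a Coxeter group is $\gamma(W)=2\min_{s\ne t}m_{s,t}$, possibly infinite (for $W_I$, the minimum is over distinct $s,t\in I$). A cyclic word on $S$ is a word modulo cyclic permutation; a cyclic loop is a cyclic word of positive length whose letters multiply to $1$ in $W$ (independent of the representative). $l_I(w)$ is the number of letters of $w$ lying in $I$. The Cayley graph $\mathrm{Cay}\,W$ has vertex set $W$ and (unoriented) edges $(v,vs)$, $v\in W$, $s\in S$. For each pair $I=\{s,t\}$ of distinct commuting elements of $S$ and each coset $vW_I$, the coset spans a $4$-cycle in $\mathrm{Cay}\,W$; the Cayley complex $\mathrm{Cay}^+W$ is the $2$-complex obtained from $\mathrm{Cay}\,W$ by attaching one square $2$-cell along each such $4$-cycle. A word $w=s_1\cdots s_n$ defines the path $|w|$ in $\mathrm{Cay}\,W$ starting at $1$ with successive vertices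 $1,s_1,s_1s_2,\dots,s_1\cdots s_n$; for a cyclic loop, $|w|$ is the closed path associated with any representative. *)

(* Defs.v *)
From HB Require Import structures.
From Stdlib Require Import Relations.
From mathcomp Require Import all_boot all_order all_algebra.
From mathcomp Require Import all_classical all_reals topology normedtype.
Import Order.TTheory GRing.Theory Num.Theory.
Import numFieldNormedType.Exports.

Set Implicit Arguments.
Unset Strict Implicit.
Unset Printing Implicit Defensive.

Local Open Scope classical_set_scope.
Local Open Scope ring_scope.

(** * Coxeter systems *)

Section Coxeter.
Variables (W : groupType) (S : finType).
Variables (gen : S -> W) (m : S -> S -> option nat).

(** [None] encodes the value oo. *)
Definition coxeter_matrix : Prop :=
  [/\ forall s, m s s = Some 1%N,
      forall s t, m s t = m t s &
      forall s t n, s != t -> m s t = Some n -> (2 <= n)%N].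

Definition word_val (w : seq S) : W := (\prod_(s <- w) gen s)%g.

(** The congruence on words generated by (s t)^(m s t) = 1. The case s = t gives
    s s = 1, so formal inverses are not needed and the quotient monoid is the
    group with presentation < S | (s t)^(m s t) = 1 when m s t is finite >. *)
Inductive coxeter_eq : seq S -> seq S -> Prop :=
| coxeter_eq_rel s t n : m s t = Some n ->
    coxeter_eq (flatten (nseq n [:: s; t])) [::]
| coxeter_eq_refl u : coxeter_eq u u
| coxeter_eq_sym u v : coxeter_eq u v -> coxeter_eq v u
| coxeter_eq_trans u v w : coxeter_eq u v -> coxeter_eq v w -> coxeter_eq u w
| coxeter_eq_cat u u' v v' : coxeter_eq u u' -> coxeter_eq v v' ->
    coxeter_eq (u ++ v) (u' ++ v').

Definition coxeter_system : Prop :=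
  [/\ coxeter_matrix,
      forall g : W, exists w, word_val w = g &
      forall u v, word_val u = word_val v <-> coxeter_eq u v].

Definition right_angled_partition (A B : {set S}) : Prop :=
  [/\ (A :|: B)%SET = finset.setT, (A :&: B)%SET = finset.set0 &
      forall s t, s \in A -> t \in B -> m s t = Some 2%N \/ m s t = None].

Definition omin (a b : option nat) : option nat :=
  match a, b with
  | Some x, Some y => Some (minn x y)
  | Some x, None => Some x
  | None, _ => b
  end.

(** The girth of W_I; it is oo ([None]) when no finite m s t occurs, in
    particular when I has at most one element. *)
Definition girth (I : {set S}) : option nat :=
  omap double
    (\big[omin/None]_(s in I) \big[omin/None]_(t in I | t != s) m s t).

Definition lt_onat (n : nat) (b : option nat) : bool :=
  if b is Some k then (n < k)%N else true.

Definition letters_in (I : {set S}) (w : seq S) : nat :=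
  count (fun s => s \in I) w.

(** Said of a representative; the condition is invariant under rotation. *)
Definition cyclic_loop (w : seq S) : Prop := w <> [::] /\ word_val w = 1%g.

End Coxeter.

(** * The unit interval and null-homotopic loops *)

Definition I01 (R : realType) : topologicalType := set_type `[0 : R, 1]%classic.

Fact clamp01_subproof (R : realType) (x : R) :
  Num.max 0 (Num.min x 1) \in `[0 : R, 1]%classic.
Proof.
by apply/mem_set; rewrite /= in_itv /= le_max lexx /= ge_max ler01 ge_min lexx orbT.
Qed.

Definition clamp01 (R : realType) (x : R) : I01 R :=
  exist _ (Num.max 0 (Num.min x 1)) (clamp01_subproof x).

Definition val01 (R : realType) (x : I01 R) : R := sval x.

(** A loop is a path with equal end points, i.e. a map on the circle; the
    homotopy is a homotopy of maps on the circle, base points being free. *)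
Definition null_homotopic (R : realType) (X : topologicalType)
    (f : I01 R -> X) : Prop :=
  exists (H : I01 R * I01 R -> X) (c : X),
    [/\ continuous H,
        forall x, H (x, clamp01 0) = f x,
        forall x, H (x, clamp01 1) = c &
        forall t, H (clamp01 0, t) = H (clamp01 1, t)].

(** * The Cayley complex *)

Section CayleyComplex.
Variables (R : realType) (W : groupType) (S : finType) (gen : S -> W).

Definition square_dart (q : W * S * S) : bool :=
  let: (_, s, t) := q in (s != t) && (gen s * gen t == gen t * gen s)%g.

(** Parametrized cells: a vertex v; an edge (v, vs) with a choice of origin v;
    a square v W_{s,t} with a choice of corner v and of first direction s. *)
Definition cell : choiceType := (W + W * S + {q : W * S * S | square_dart q})%type.

Definition cell_space (c : cell) : topologicalType :=
  match c with
  | inl (inl _) => discrete_topology unit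
  | inl (inr _) => I01 R
  | inr _ => (I01 R * I01 R)%type
  end.

Definition cell_sum : topologicalType := {c : cell & cell_space c}.

Definition vertex_pt (v : W) : cell_sum :=
  existT cell_space (inl (inl v)) tt.
Definition edge_pt (v : W) (s : S) (x : I01 R) : cell_sum :=
  existT cell_space (inl (inr (v, s))) x.
Definition square_pt (v : W) (s t : S) (h : square_dart (v, s, t))
    (x y : I01 R) : cell_sum :=
  existT cell_space (inr (exist _ (v, s, t) h)) (x, y).

(** [glue_edge_flip] identifies the two parametrizations of an edge;
    [glue_square_flip] and [glue_square_swap] identify the eight ones of a
    square. Up to these, [glue_edge_end] and [glue_square_side] are the attaching
    maps: the square with corner v and directions s, t has vertices v, vs, vst, vt
    at (0,0), (1,0), (1,1), (0,1). *)
Inductive glue : cell_sum -> cell_sum -> Prop :=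
| glue_edge_end v s x : val01 x = 0 ->
    glue (edge_pt v s x) (vertex_pt v)
| glue_edge_flip v s x x' : val01 x' = 1 - val01 x ->
    glue (edge_pt v s x) (edge_pt (v * gen s)%g s x')
| glue_square_side v s t h x y : val01 y = 0 ->
    glue (@square_pt v s t h x y) (edge_pt v s x)
| glue_square_flip v s t h h' x x' y : val01 x' = 1 - val01 x ->
    glue (@square_pt v s t h x y) (@square_pt (v * gen s)%g s t h' x' y)
| glue_square_swap v s t h h' x y :
    glue (@square_pt v s t h x y) (@square_pt v t s h' y x).

Definition glued (p q : cell_sum) : bool :=
  `[< clos_refl_sym_trans cell_sum glue p q >].

Fact glued_refl : reflexive glued.
Proof. by move=> p; apply/asboolP; exact: rst_refl. Qed.

Fact glued_sym : symmetric glued.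
Proof.
by move=> p q; apply/asboolP/asboolP => h; exact: rst_sym.
Qed.

Fact glued_trans : transitive glued.
Proof.
move=> q p r /asboolP pq /asboolP qr; apply/asboolP.
exact: rst_trans pq qr.
Qed.

Canonical glued_equiv := EquivRel glued glued_refl glued_sym glued_trans.

Definition cayley_complex : topologicalType :=
  quotient_topology {eq_quot glued_equiv}%qT.

Definition cell_proj (p : cell_sum) : cayley_complex :=
  (\pi_(quotient_topology {eq_quot glued_equiv}) p)%qT.

(** The edge path from v reading w, each edge taking unit time. *)
Fixpoint walk (v : W) (w : seq S) (x : R) : cayley_complex :=
  if w is s :: w' then
    if x <= 1 then cell_proj (edge_pt v s (clamp01 x))
    else walk (v * gen s)%g w' (x - 1)
  else cell_proj (vertex_pt v).

Definition word_path (w : seq S) (x : I01 R) : cayley_complex :=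
  walk 1%g w (val01 x * (size w)%:R).

End CayleyComplex.

(* Main.v *)
(**
Fix a colour A among R and B, and call a conjugate of a letter of A by an element
of the subgroup generated by the other colour an A-reflection. Conjugating every
A-letter of a trivial word by the letters of the other colour that precede it
gives a trivial product of A-reflections, since W retracts onto the subgroup of
the other colour.

A trivial product of A-reflections crosses each wall an even number of times, and
the product of two distinct A-reflections has order at least the least exponent
m(s,t) with s, t in A (or infinite order); the latter is read off an explicit
linear representation of W. By induction on the length, a trivial product of fewer
than gamma(W_A) A-reflections has two equal consecutive factors: otherwise every
wall is crossed exactly at two antipodal places, which forces the product to be a
power (x y)^k with k below the least exponent.

For A = B this yields a factor b r b of w, where r is a word in R commuting with b;
after a rotation of w, r contains at most half of the R-letters of w. For A = R
applied to b r b r^-1, the word r reduces by cancellations to letters commuting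
with b, so b r b can be replaced by r. Hence w reduces to the empty word by
cancellations s s -> 1 and swaps of commuting letters, and each such move is
realized by a homotopy in the Cayley complex.
*)

Require Import Defs.
From Stdlib Require Import Relations.
From mathcomp Require Import all_boot all_order all_algebra all_field.
From mathcomp Require Import all_classical all_reals topology normedtype.
From mathcomp Require Import zify ring lra.
Import Order.TTheory GRing.Theory Num.Theory.
Import numFieldNormedType.Exports.

Set Implicit Arguments.
Unset Strict Implicit.
Unset Printing Implicit Defensive.

(** * Sequences without equal neighbours *)

Definition adjacent_free (T : eqType) (y : seq T) : bool :=
  sorted (fun a b => a != b) y.

Lemma adjacent_freePn (T : eqType) (y : seq T) : ~~ adjacent_free y ->
  exists p a q, y = p ++ a :: a :: q.
Proof.
rewrite /adjacent_free.
elim: y => [//|a [//|b y] IH] /=; rewrite negb_and negbK => /orP[/eqP->|].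
  by exists [::], b, y.
by move=> /IH[p [c [q ->]]]; exists (a :: p), c, q.
Qed.

Lemma adjacent_free_cat (T : eqType) (p q : seq T) :
  adjacent_free (p ++ q) -> adjacent_free p /\ adjacent_free q.
Proof. by rewrite /adjacent_free => /cat_sorted2[-> ->]. Qed.

Lemma adjacent_free_rev (T : eqType) (y : seq T) :
  adjacent_free (rev y) = adjacent_free y.
Proof.
rewrite /adjacent_free rev_sorted; apply: eq_sorted => a b /=; by rewrite eq_sym.
Qed.

Lemma adjacent_free_join (T : eqType) (p q : seq T) a :
  adjacent_free (p ++ [:: a]) -> adjacent_free (a :: q) ->
  adjacent_free (p ++ a :: q).
Proof.
rewrite /adjacent_free; case: p => [//|b p] /=.
by rewrite !cat_path /= => /and3P[-> -> _] ->.
Qed.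

Lemma conj_self (G : groupType) (a : G) : (a ^ a = a)%g.
Proof. by rewrite conjgE mulKg. Qed.

Lemma mul_expg_swap (G : groupType) (a b : G) n :
  (a * (b * a) ^+ n = (a * b) ^+ n * a)%g.
Proof.
elim: n => [|n IH]; first by rewrite mulg1 mul1g.
by rewrite !expgS mulgA -!mulgA -IH !mulgA.
Qed.

(** * Words in a Coxeter system *)

Section Words.
Variables (W : groupType) (S : finType) (gen : S -> W).
Variables (m : S -> S -> option nat).
Local Notation val := (word_val gen).
Local Open Scope group_scope.

Lemma word_val_nil : val [::] = 1.
Proof. by rewrite /word_val big_nil. Qed.

Lemma word_val_cons s w : val (s :: w) = gen s * val w.
Proof. by rewrite /word_val big_cons. Qed.

Lemma word_val_cat u v : val (u ++ v) = val u * val v.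
Proof. by rewrite /word_val big_cat. Qed.

Lemma word_val_pow n u : val (flatten (nseq n u)) = val u ^+ n.
Proof.
elim: n => [|n IH]; first by rewrite /= word_val_nil.
by rewrite /= word_val_cat IH expgS.
Qed.

Hypothesis cs : coxeter_system gen m.

Lemma word_val_coxeter u v : coxeter_eq m u v -> val u = val v.
Proof. by case: cs => _ _ h /h. Qed.

Lemma gen_sq s : gen s * gen s = 1.
Proof.
case: cs => [[h _ _] _ _].
have := word_val_coxeter (coxeter_eq_rel (h s)).
by rewrite /= !word_val_cons word_val_nil mulg1.
Qed.

Lemma genV s : (gen s)^-1 = gen s.
Proof. by apply: mulg1_eq; exact: gen_sq. Qed.

Lemma gen_conj_sq s (x : W) : (x ^ gen s) ^ gen s = x.
Proof. by rewrite -conjgM gen_sq conjg1. Qed.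

Lemma word_val_rev w : val (rev w) = (val w)^-1.
Proof.
elim: w => [|s w IH]; first by rewrite word_val_nil invg1.
by rewrite rev_cons -cats1 word_val_cat IH !word_val_cons word_val_nil mulg1
  invgM genV.
Qed.

Lemma coxeter_eq_pairP s t n : m s t = Some n -> (gen s * gen t) ^+ n = 1.
Proof.
move=> h; have := word_val_coxeter (coxeter_eq_rel h).
by rewrite word_val_pow !word_val_cons word_val_nil mulg1.
Qed.

Lemma gen_comm s t : m s t = Some 2%N -> gen s * gen t = gen t * gen s.
Proof.
move/coxeter_eq_pairP; rewrite expg2 => /mulg1_eq.
by rewrite invgM !genV.
Qed.

Lemma m_sym s t : m s t = m t s.
Proof. by case: cs => [[]]. Qed.

Lemma m_diag s : m s s = Some 1%N.
Proof. by case: cs => [[]]. Qed.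

Lemma m_ge2 s t n : s != t -> m s t = Some n -> (2 <= n)%N.
Proof. by case: cs => [[_ _ h] _ _]; exact: h. Qed.

Variable A : {set S}.
Hypothesis raA : forall s t, s \in A -> t \notin A -> m s t = Some 2%N \/ m s t = None.

Lemma mixed_exponent s t n : (s \in A) != (t \in A) -> m s t = Some n -> n = 2.
Proof.
case sA: (s \in A); case tA: (t \in A) => // _ mst.
  by have [] := raA sA (negbT tA); rewrite mst // => -[].
by have [] := raA tA (negbT sA); rewrite m_sym mst // => -[].
Qed.

(** * Parity of the walls crossed *)

(* Parity of the number of letters of [w] in [A] that cross the wall of [x]. *)
Fixpoint wall_parity (w : seq S) (x : W) : bool :=
  if w is s :: w' then
    ((s \in A) && (gen s == x)) (+) wall_parity w' (x ^ gen s)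
  else false.

Lemma wall_parity_cat u v x :
  wall_parity (u ++ v) x = wall_parity u x (+) wall_parity v (x ^ val u).
Proof.
elim: u x => [|s u IH] x; first by rewrite word_val_nil conjg1.
by rewrite /= IH word_val_cons conjgM addbA.
Qed.

Lemma wall_parity_out g x : all (fun s => s \notin A) g -> wall_parity g x = false.
Proof. by elim: g x => //= s g IH x /andP[/negbTE-> /IH->]. Qed.

Fixpoint alternating (s t : S) (n : nat) : seq S :=
  if n is n'.+1 then s :: alternating t s n' else [::].

Lemma alternating_double s t n :
  alternating s t (n + n) = flatten (nseq n [:: s; t]).
Proof. by elim: n => //= n IH; rewrite addnS /= IH. Qed.

(** The letter at place j of s t s t ..., conjugated by the prefix before it, is the reflection (s
    t)^j s. *)
Lemma wall_parity_alternating s t n x : s \in A -> t \in A ->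
  wall_parity (alternating s t n) x =
  \big[addb/false]_(0 <= j < n) ((gen s * gen t) ^+ j * gen s == x).
Proof.
elim: n s t x => [|n IH] s t x sA tA; first by rewrite big_geq.
rewrite /= sA IH // big_nat_recl // expg0 mul1g; congr (_ (+) _).
apply: eq_bigr => j _; rewrite -(inj_eq (@conjg_inj _ (gen s))) gen_conj_sq.
by rewrite conjgE genV !mulgA mul_expg_swap expgSr !mulgA.
Qed.

(** It suffices to treat a relator (s t)^n. For two letters of [A] the reflections (s t)^j s, j <
    2n, have period n and cancel in pairs. For two letters outside [A] nothing is counted. In the
    mixed case n = 2, and since s and t commute both occurrences of the letter of [A] cross the same
    wall. *)
Lemma wall_parity_coxeter u v : coxeter_eq m u v ->
  forall x, wall_parity u x = wall_parity v x.
Proof.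
elim=> {u v} [s t n mst x|//|u v _ IH x|u v w _ IHu _ IHv x|u u' v v' hu IHu hv IHv x].
- case: (eqVneq (s \in A) (t \in A)) => stA; last first.
    have n2 := mixed_exponent stA mst; move: mst; rewrite n2 => mst.
    have cst := gen_comm mst.
    have fixs y : (gen s == (y ^ gen s) ^ gen t) = (gen s == y).
      rewrite -conjgM -{1}[gen s](_ : gen s ^ (gen s * gen t) = _)
        ?(inj_eq (@conjg_inj _ _)) //.
      by rewrite conjgM conj_self conjgE cst mulKg.
    have fixt y : (gen t == (y ^ gen t) ^ gen s) = (gen t == y).
      rewrite -conjgM -{1}[gen t](_ : gen t ^ (gen t * gen s) = _)
        ?(inj_eq (@conjg_inj _ _)) //.
      by rewrite conjgM conj_self conjgE -cst mulKg.
    rewrite /= addbF fixs fixt.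
    by move: stA; case: (s \in A); case: (t \in A) => //= _; rewrite ?addbF addbb.
  rewrite -alternating_double.
  case sA: (s \in A); last first.
    rewrite wall_parity_out //; move: (n + n)%N => k.
    have tA : t \in A = false by rewrite -stA.
    elim: k s t sA tA {stA mst x} => //= k IH s t sA tA.
    by rewrite sA IH.
  rewrite wall_parity_alternating -?stA //.
  rewrite (@big_cat_nat _ _ _ n) ?leq_addr //= -{2}[n]addn0 addnC big_addn addnK.
  rewrite -[RHS](addbb (\big[addb/false]_(0 <= j < n)
    ((gen s * gen t) ^+ j * gen s == x))); congr (_ (+) _).
  by apply: eq_bigr => j _; rewrite expgnDr (coxeter_eq_pairP mst) mulg1.
- by rewrite IH.
- by rewrite IHu IHv.
- by rewrite !wall_parity_cat IHu IHv (word_val_coxeter hu).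
Qed.

(** * Trivial products of [A]-reflections *)

Definition conj_letter (x : W) : Prop :=
  exists a g, [/\ a \in A, all (fun s => s \notin A) g & x = gen a ^ val g].

Lemma conj_letter_sq x : conj_letter x -> x * x = 1.
Proof. by case=> a [g [_ _ ->]]; rewrite -conjMg gen_sq conj1g. Qed.

Lemma prod_rev (y : seq W) : (forall x, x \in y -> conj_letter x) ->
  \prod_(x <- rev y) x = (\prod_(x <- y) x)^-1.
Proof.
elim: y => [|a y IH] h; first by rewrite !big_nil invg1.
rewrite rev_cons -cats1 big_cat /= big_seq1 big_cons invgM IH; last first.
  by move=> x xy; apply: h; rewrite inE xy orbT.
by congr (_ * _); apply/esym/mulg1_eq/conj_letter_sq/h/mem_head.
Qed.

(** The analogue of [wall_parity] for a product of reflections, each of which crosses its own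
    wall. *)
Fixpoint list_parity (y : seq W) (x : W) : bool :=
  if y is a :: y' then (a == x) (+) list_parity y' (x ^ a) else false.

(** The reflection g^-1 a g is spelled by [rev g ++ a :: g], whose only letter in [A] is [a]; so
    this word crosses just the wall of the reflection. *)
Lemma list_parity_lift (y : seq W) : (forall x, x \in y -> conj_letter x) ->
  exists w, val w = \prod_(x <- y) x /\ wall_parity w =1 list_parity y.
Proof.
elim: y => [|x y IH] h; first by exists [::]; rewrite word_val_nil big_nil.
have [z zy|w [vw pw]] := IH; first by apply: h; rewrite inE zy orbT.
have [a [g [aA gA xE]]] := h x (mem_head _ _).
have vx : val (rev g ++ a :: g) = x.
  by rewrite word_val_cat word_val_rev word_val_cons xE conjgE.
exists ((rev g ++ a :: g) ++ w); split.
  by rewrite word_val_cat vx vw big_cons.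
move=> t; rewrite wall_parity_cat vx pw /=; congr (_ (+) _).
rewrite wall_parity_cat /= !wall_parity_out ?all_rev // aA addbF /=.
by rewrite word_val_rev -(inj_eq (@conjg_inj _ (val g))) conjgKV xE.
Qed.

Lemma list_parity_occ (y : seq W) x : list_parity y x ->
  exists u b q, y = u ++ b :: q /\ b = x ^ (\prod_(z <- u) z).
Proof.
elim: y x => [//|a y IH] x /=; case: eqP => [->|_] /= h.
  by exists [::], x, y; rewrite big_nil conjg1.
have [u [b [q [-> ->]]]] := IH _ h.
by exists (a :: u), ((x ^ a) ^ \prod_(z <- u) z), q; rewrite big_cons conjgM.
Qed.

(** A trivial product crosses the wall of [a] an even number of times. The first factor crosses it,
    so a later one must cross it too. *)
Lemma first_wall_recrossed a (y : seq W) :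
  (forall x, x \in a :: y -> conj_letter x) -> \prod_(x <- a :: y) x = 1 ->
  exists u b q, y = u ++ b :: q /\ b = a ^ (\prod_(z <- u) z).
Proof.
move=> h p1; have [w [vw pw]] := list_parity_lift h.
have /wall_parity_coxeter/(_ a) : coxeter_eq m w [::].
  by case: cs => _ _ <-; rewrite vw p1 word_val_nil.
by rewrite pw /= eqxx conj_self => /negbFE/list_parity_occ.
Qed.

(** Deleting the letters of [A] respects the relators: a mixed one has exponent 2 and becomes the
    square of a letter. This is the retraction of [W] onto the subgroup of the other colour. *)
Lemma retraction u v : coxeter_eq m u v ->
  val [seq s <- u | s \notin A] = val [seq s <- v | s \notin A].
Proof.
elim=> {u v} [s t n mst|//|u v _ IH|u v w _ IHu _ IHv|u u' v v' _ IHu _ IHv].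
- have e k : [seq s0 <- flatten (nseq k [:: s; t]) | s0 \notin A] =
      flatten (nseq k [seq s0 <- [:: s; t] | s0 \notin A]).
    by elim: k => //= k IH; rewrite -[RHS]/(_ ++ _) -IH; do 2 case: ifP.
  rewrite e word_val_pow /= word_val_nil.
  case: (eqVneq (s \in A) (t \in A)) => stA.
    rewrite -stA; case: (s \in A) => /=.
     by rewrite word_val_nil expg1n.
    by rewrite !word_val_cons word_val_nil mulg1 (coxeter_eq_pairP mst).
  rewrite (mixed_exponent stA mst) expg2.
  move: stA; case: (s \in A); case: (t \in A) => //= _;
    by rewrite word_val_cons word_val_nil mulg1 gen_sq.
- by rewrite IH.
- by rewrite IHu.
- by rewrite !filter_cat !word_val_cat IHu IHv.
Qed.
End Words.

(** * A linear representation *)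

Section Reflections.
Local Open Scope ring_scope.
Variables (F : fieldType) (I : Type) (K : I -> I -> F).

(** Here [f] is a linear form given by its values on basis vectors e_p, and it is composed with the
    reflection e_p -> e_p - K(i,p) e_i. *)
Definition reflection (i : I) (f : I -> F) : I -> F :=
  fun p => f p - K i p * f i.

Variables (i j : I) (z : F).
Hypotheses (Kii : K i i = 2) (Kjj : K j j = 2).
Hypotheses (Kij : K i j = - (z + z^-1)) (Kji : K j i = - (z + z^-1)).
Hypotheses (z0 : z != 0) (z1 : z ^+ 2 != 1).

Let T f := reflection i (reflection j f).

(* [f i + y * f j] for [y = z], [y = 1/z] are eigenfunctionals of the rotation
   [T], with eigenvalues [z^2] and [1/z^2]. *)
Lemma rotation_eigen y n f : y = z \/ y = z^-1 ->
  iter n T f i + y * iter n T f j = y ^+ (2 * n) * (f i + y * f j).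
Proof.
move=> hy; elim: n => [|n IH]; first by rewrite muln0 expr0 mul1r.
rewrite mulnS exprD -mulrA -IH iterS; set h := iter n T f.
rewrite /T /reflection Kii Kjj Kij Kji.
by case: hy => ->; field.
Qed.

Lemma rotation_iter n f : z ^+ (2 * n) = 1 -> iter n T f = f.
Proof.
move=> zn; apply/funext => p.
have z2 : z ^+ 2 - 1 != 0 by rewrite subr_eq0.
(* Evaluation at [p] is corrected by multiples of the two eigenfunctionals so as to become
   [T]-invariant; the eigenvalues differ from 1 because z^2 != 1. After n turns the corrections
   return to their initial values, hence so does the value at [p]. *)
pose phi (h : I -> F) := h p
  + (K i p + (K j p + z^-1 * K i p) / (z - z^-1)) / (z ^+ 2 - 1) * (h i + z * h j)
  - (K j p + z^-1 * K i p) / (z - z^-1) / (z^-1 ^+ 2 - 1) * (h i + z^-1 * h j).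
have phiT h : phi (T h) = phi h.
  rewrite /phi /T /reflection Kii Kjj Kij Kji; field.
  by rewrite z0 mulN1r -opprB oppr_eq0 -expr2 z2.
have phin k : phi (iter k T f) = phi f by elim: k => //= k; rewrite phiT.
have := phin n; rewrite /phi !rotation_eigen; [|by right|by left].
rewrite (exprVn z (2 * n)) zn invr1 !mul1r => /addIr/addIr; exact.
Qed.

Lemma rotation_order n : (forall f, iter n T f = f) -> i <> j -> z ^+ (2 * n) = 1.
Proof.
(* On the indicator of [i] the eigenfunctional takes the value 1, so the equation for n turns reads
   1 = z^(2n). *)
move=> h ij; pose f p : F := `[< p = i >]%:R.
have := @rotation_eigen z n f (or_introl erefl); rewrite h /f.
rewrite asboolT // asboolF; last by move/esym.
by rewrite mulr0 addr0 mulr1.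
Qed.
End Reflections.

(** The order is 2n, so that a rotation with eigenvalues z^2 and z^-2 has order n. The predecessor
    keeps the definition total at n = 0. *)
Definition root_of_order (n : nat) : algC :=
  sval (C_prim_root_exists (ltn0Sn n.*2.-1)).

Lemma root_of_orderP n : (0 < n)%N -> ((n.*2).-primitive_root (root_of_order n))%R.
Proof.
move=> n0; rewrite /root_of_order; case: C_prim_root_exists => z /=.
by rewrite prednK // double_gt0.
Qed.

(** * The action of [W] on functions on the reflections *)

Section Representation.
Variables (W : groupType) (S : finType) (gen : S -> W).
Variables (m : S -> S -> option nat).
Local Notation val := (word_val gen).
Hypothesis cs : coxeter_system gen m.
Variable A : {set S}.
Hypothesis raA : forall s t, s \in A -> t \notin A ->
  m s t = Some 2%N \/ m s t = None.
Local Notation out g := (all (fun s => s \notin A) g).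

(* A pair [(b, x)] with [b] in [A] stands for the reflection [x], a conjugate of
   [b] by a word [g] outside [A]. These reflections generate a Coxeter group in
   which [(b, x)] and [(c, y)] have exponent [m b c] if one [g] works for both, and
   infinity otherwise; [cartan] is a Cartan matrix of it, where any number that is
   not a root of unity, here 2, encodes infinity. *)
Definition jointly_conj (p q : S * W) : Prop :=
  p.1 != q.1 /\ exists g,
    [/\ out g, p.2 = (gen p.1 ^ val g)%g & q.2 = (gen q.1 ^ val g)%g].

Definition rot_root (p q : S * W) : algC :=
  if `[< jointly_conj p q >] then
    if m p.1 q.1 is Some n then root_of_order n else 2%R
  else 2%R.

Definition cartan (p q : S * W) : algC :=
  if p == q then 2%R else (- (rot_root p q + (rot_root p q)^-1))%R.

Definition conj_pair (g : W) (p : S * W) : S * W := (p.1, p.2 ^ g)%g.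

(** [W] is the semidirect product of the group generated by the [A]-reflections with the subgroup of
    the other colour: the former acts by its reflection representation, the latter permutes the
    basis. *)
Definition act (s : S) (f : S * W -> algC) : S * W -> algC :=
  if s \in A then reflection cartan (s, gen s) f
  else fun p => f (conj_pair (gen s) p).

Definition act_word (w : seq S) (f : S * W -> algC) := foldr act f w.

Lemma act_word_cat u v f : act_word (u ++ v) f = act_word u (act_word v f).
Proof. exact: foldr_cat. Qed.

Lemma act_word_out g f : out g ->
  act_word g f = fun p => f (conj_pair (val g) p).
Proof.
elim: g f => [|s g IH] f /=.
  by move=> _; apply/funext => -[b x]; rewrite /conj_pair /= word_val_nil conjg1.
move=> /andP[/negbTE sA gA]; rewrite IH // /act sA; apply/funext => -[b x].
by rewrite /conj_pair /= word_val_cons conjgM.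
Qed.

Lemma jointly_conj_sym p q : jointly_conj p q -> jointly_conj q p.
Proof. by case=> pq [g [go pE qE]]; split; [rewrite eq_sym|exists g]. Qed.

Lemma rot_root_sym p q : rot_root p q = rot_root q p.
Proof.
rewrite /rot_root (_ : `[< _ >] = `[< jointly_conj q p >]) ?(m_sym cs p.1) //.
by apply/asboolP/asboolP; exact: jointly_conj_sym.
Qed.

Lemma cartan_sym p q : cartan p q = cartan q p.
Proof. by rewrite /cartan eq_sym rot_root_sym. Qed.

Lemma jointly_conj_conj g p q : out g -> jointly_conj p q ->
  jointly_conj (conj_pair (val g) p) (conj_pair (val g) q).
Proof.
move=> go [pq [h [ho pE qE]]]; split=> //; exists (h ++ g).
by rewrite /= all_cat ho go word_val_cat !conjgM -pE -qE.
Qed.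

Lemma conj_pairK g : cancel (conj_pair (val g)) (conj_pair (val (rev g))).
Proof. by move=> [b x]; rewrite /conj_pair /= (word_val_rev cs) conjgK. Qed.

(** Conjugation prolongs a common conjugator by [g], and [rev g] undoes it. This invariance lets the
    permutations of the basis carry reflections to reflections. *)
Lemma cartan_conj g p q : out g ->
  cartan (conj_pair (val g) p) (conj_pair (val g) q) = cartan p q.
Proof.
move=> go; rewrite /cartan (can_eq (conj_pairK g)); case: eqP => // _.
suff -> : rot_root (conj_pair (val g) p) (conj_pair (val g) q) = rot_root p q by [].
rewrite /rot_root (_ : `[< _ >] = `[< jointly_conj p q >]) //.
apply/asboolP/asboolP; last exact: jointly_conj_conj.
have gro : out (rev g) by rewrite all_rev.
by move=> /(jointly_conj_conj gro); rewrite !conj_pairK.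
Qed.

Lemma rot_root_neq0 p q : rot_root p q != 0%R.
Proof.
rewrite /rot_root; case: asboolP => [[pq _]|_]; last by rewrite pnatr_eq0.
case mE: (m _ _) => [n|]; last by rewrite pnatr_eq0.
have n2 := m_ge2 cs pq mE.
apply/eqP => z0; have /eqP := prim_expr_order (root_of_orderP (ltnW n2)).
by rewrite z0 expr0n double_eq0 -[n]prednK ?(ltnW n2) //= eq_sym oner_eq0.
Qed.

(** The number 2 is not a root of unity, so the root is a primitive 2n-th one, and 2n divides 2k. *)
Lemma rot_root_expr p q k : (0 < k)%N -> (rot_root p q ^+ (2 * k) = 1)%R ->
  p.1 != q.1 /\ exists2 n, m p.1 q.1 = Some n & (n <= k)%N.
Proof.
move=> k0; have two : (2 ^+ (2 * k) = 1 :> algC)%R -> False.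
  move/eqP; rewrite -natrX (eqr_nat _ _ 1) => /eqP.
  by have := ltn_expl (2 * k) (isT : 1 < 2)%N; lia.
rewrite /rot_root; case: asboolP => [[pq _]|_ /two//].
case mE: (m _ _) => [n|] e; last by case: (two e).
split=> //; exists n => //.
have n2 := m_ge2 cs pq mE.
have := prim_order_dvd (root_of_orderP (ltnW n2)) (2 * k).
rewrite e eqxx -muln2 [(n * 2)%N]mulnC dvdn_pmul2l // => /dvdn_leq; exact.
Qed.

Lemma rot_root_sqr p q : (rot_root p q ^+ 2 != 1)%R.
Proof.
apply/negP => /eqP h; have [] := @rot_root_expr p q 1 isT; first by rewrite muln1.
by move=> pq [n mE]; have := m_ge2 cs pq mE; lia.
Qed.

Lemma cartan_diag p : cartan p p = 2%R.
Proof. by rewrite /cartan eqxx. Qed.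

Lemma reflection_conj g b f : out g -> b \in A ->
  act_word (rev g ++ b :: g) f = reflection cartan (b, gen b ^ val g)%g f.
Proof.
move=> go bA; rewrite act_word_cat act_word_out ?all_rev //=.
rewrite /act bA act_word_out // /reflection; apply/funext => p.
have e : conj_pair (val g) (conj_pair (val (rev g)) p) = p.
  by rewrite -{1}(revK g) conj_pairK.
by rewrite e -(cartan_conj (b, gen b) _ go) e.
Qed.

(** Two letters outside [A] satisfy their relation already in [W], and a reflection is an
    involution. Distinct letters of [A] are jointly conjugate by the empty word, so their parameter
    is a primitive 2n-th root and [rotation_iter] applies. In the mixed case n = 2, and conjugation
    by one letter leaves the reflection in the other unchanged. *)
Lemma act_word_coxeter u v : coxeter_eq m u v -> act_word u = act_word v.
Proof.
elim=> {u v} [s t n mst|//|u v _ ->//|u v w _ -> //|u u' v v' _ IHu _ IHv]; last first.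
  by apply/funext => f; rewrite !act_word_cat IHu IHv.
apply/funext => f /=.
have it k : act_word (flatten (nseq k [:: s; t])) f =
    iter k (fun f => act s (act t f)) f by elim: k => //= k ->.
case: (eqVneq (s \in A) (t \in A)) => stA.
  case sA: (s \in A); last first.
    rewrite act_word_out.
      rewrite word_val_pow !word_val_cons word_val_nil mulg1 (coxeter_eq_pairP cs mst).
      by apply/funext => -[b x]; rewrite /conj_pair conjg1.
    have tA : t \in A = false by rewrite -stA.
    by elim: (n) => //= k ->; rewrite sA tA.
  have tA : t \in A by rewrite -stA.
  rewrite it /act sA tA; case: (eqVneq s t) => st.
    move: mst; rewrite -st (m_diag cs) => -[<-] /=.
    apply/funext => p; rewrite /reflection cartan_diag; ring.
  have e : rot_root (s, gen s) (t, gen t) = root_of_order n.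
    rewrite /rot_root /= mst asboolT //; split=> //.
    by exists [::]; rewrite /= word_val_nil !conjg1.
  have ne : ((s, gen s) == (t, gen t)) = false.
    by apply/negP => /eqP[/eqP]; rewrite (negbTE st).
  apply: (@rotation_iter _ _ _ _ _ (root_of_order n)); rewrite ?cartan_diag //.
  - by rewrite /cartan ne e.
  - by rewrite cartan_sym /cartan ne e.
  - by rewrite -e rot_root_neq0.
  - by rewrite -e rot_root_sqr.
  - by rewrite mul2n; apply/prim_expr_order/root_of_orderP/ltnW/(m_ge2 cs st mst).
have n2 := mixed_exponent cs raA stA mst; move: mst it; rewrite n2 => mst it.
have cst := gen_comm cs mst.
have key b c : b \in A -> c \notin A -> (gen b ^ gen c = gen b)%g ->
    forall f, act c (act b (act c f)) = act b f.
  move=> bA cA bc h; have := @reflection_conj [:: c] b h; rewrite /= cA => -> //.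
  by rewrite word_val_cons word_val_nil mulg1 bc /act bA.
have sq c h : act c (act c h) = h.
  rewrite /act; case: ifP => cA; apply/funext => p; rewrite ?cA.
    by rewrite /reflection cartan_diag; ring.
  by case: p => b x; rewrite /conj_pair /= (gen_conj_sq cs).
rewrite it /=; move: stA; case sA: (s \in A); case tA: (t \in A) => // _.
  rewrite (key s t) ?sq ?tA //.
  by rewrite conjgE (genV cs) cst mulgA (gen_sq cs) mul1g.
rewrite (key t s) ?sq ?sA //.
by rewrite conjgE (genV cs) -cst mulgA (gen_sq cs) mul1g.
Qed.

(** A word for x y acts as the rotation of the two reflections. If its k-th power is trivial,
    [rotation_order] gives z^(2k) = 1, and [rot_root_expr] bounds the exponent. *)
Lemma conj_letters_order b c g h k : b \in A -> c \in A -> out g -> out h ->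
  let x := (gen b ^ val g)%g in let y := (gen c ^ val h)%g in
  (b, x) <> (c, y) -> (0 < k)%N -> ((x * y) ^+ k = 1)%g ->
  b != c /\ exists2 n, m b c = Some n & (n <= k)%N.
Proof.
move=> bA cA go ho x y ne k0 xyk.
pose w := (rev g ++ b :: g) ++ (rev h ++ c :: h).
have vw : val w = (x * y)%g.
  by rewrite !word_val_cat !(word_val_rev cs) !word_val_cons /x /y !conjgE.
have cw : coxeter_eq m (flatten (nseq k w)) [::].
  by case: cs => _ _ <-; rewrite word_val_pow vw xyk word_val_nil.
apply: (@rot_root_expr (b, x) (c, y)) => //.
apply: (@rotation_order _ _ cartan (b, x) (c, y)) => //.
- exact: cartan_diag.
- exact: cartan_diag.
- by rewrite /cartan; case: eqP.
- by rewrite cartan_sym /cartan; case: eqP.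
- exact: rot_root_neq0.
move=> f; rewrite -[RHS](congr1 (@^~ f) (act_word_coxeter cw)).
elim: k {k0 xyk cw} => //= k ->; rewrite act_word_cat.
by rewrite act_word_cat !reflection_conj.
Qed.

(** Were the letters distinct, x x = 1 would be the case k = 1 of [conj_letters_order] and give an
    exponent at most 1. *)
Lemma conj_letter_inj b c g h : b \in A -> c \in A -> out g -> out h ->
  (gen b ^ val g = gen c ^ val h)%g -> b = c.
Proof.
move=> bA cA go ho e; apply/eqP/negPn/negP => bc.
have [||_ [n mE n1]] := @conj_letters_order b c g h 1 bA cA go ho _ isT.
- by case=> /eqP; rewrite (negbTE bc).
- by rewrite -e expg1 -conjMg (gen_sq cs) conj1g.
by have := m_ge2 cs bc mE; lia.
Qed.

Lemma gen_inj : {in A &, injective gen}.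
Proof.
move=> b c bA cA e; apply: (@conj_letter_inj b c [::] [::]) => //.
by rewrite word_val_nil !conjg1.
Qed.
End Representation.

(** * Short loops *)

Section ShortLoops.
Variables (W : groupType) (S : finType) (gen : S -> W).
Variables (m : S -> S -> option nat).
Local Notation val := (word_val gen).
Hypothesis cs : coxeter_system gen m.
Variable A : {set S}.
Hypothesis raA : forall s t, s \in A -> t \notin A ->
  m s t = Some 2%N \/ m s t = None.
Local Notation conj_letters y := (forall x, x \in y -> conj_letter gen A x).
Local Notation prod y := (\prod_(x <- y) x)%g.

(** The inequality n < gamma(W_A), spelled out over the finite exponents so as to cover infinite
    girth as well. *)
Definition below_girth (n : nat) : Prop :=
  forall b c k, b \in A -> c \in A -> b != c -> m b c = Some k -> (n < 2 * k)%N.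

Lemma below_girth_le n n' : (n <= n')%N -> below_girth n' -> below_girth n.
Proof. by move=> le h b c k bA cA bc mE; apply: leq_ltn_trans le (h _ _ _ _ _ _ mE). Qed.

Lemma conj_letters_sub (y z : seq W) :
  {subset z <= y} -> conj_letters y -> conj_letters z.
Proof. by move=> zy h x /zy/h. Qed.

Lemma prod_rot j (y : seq W) : prod y = 1%g -> prod (rot j y) = 1%g.
Proof.
rewrite /rot -{1}(cat_take_drop j y) !big_cat /= => h.
by apply: (mulgI (prod (take j y))); rewrite mulgA h mul1g mulg1.
Qed.

Lemma alternating_prod (y : seq W) k a b : size y = (k + k)%N ->
  (forall i, (i.+2 < size y)%N -> nth 1%g y i = nth 1%g y i.+2) ->
  (0 < k)%N -> nth 1%g y 0 = a -> nth 1%g y 1 = b ->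
  prod y = ((a * b) ^+ k)%g.
Proof.
elim: k y => [//|k IH] [//|a' [//|b' y]] /=; rewrite addnS //= => -[sy] h _ ea eb.
rewrite !big_cons expgS mulgA ea eb; congr (_ * _)%g.
case: (posnP k) => [k0|k0].
  by move: sy; rewrite k0 => /size0nil ->; rewrite big_nil.
have sy2 : (1 < size y)%N by rewrite sy; lia.
apply: IH => //.
- by move=> i hi; apply: (h i.+2).
- by rewrite -ea; apply/esym/(h 0); lia.
- by rewrite -eb; apply/esym/(h 1); lia.
Qed.

Lemma nth_rot (T : Type) (x : T) (y : seq T) j i :
  (j <= size y)%N -> (i < size y)%N ->
  nth x (rot j y) i = nth x y (if i + j < size y then i + j else i + j - size y)%N.
Proof.
move=> jy iy; rewrite /rot nth_cat size_drop nth_drop.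
rewrite ltn_subRL addnC; case: ifP => h; first by [].
rewrite nth_take; last by lia.
by congr (nth _ _ _); lia.
Qed.

Section Step.
Variable n : nat.
Hypothesis IH : forall z : seq W, (size z < n)%N -> z <> [::] -> conj_letters z ->
  prod z = 1%g -> below_girth (size z) -> ~~ adjacent_free z.

(** A one-term sequence fails the test, being its own cyclic neighbour. *)
Definition cyclically_free (y : seq W) : bool :=
  if y is a :: y' then adjacent_free y && (last a y' != a) else true.

(** Let b be a factor recrossing the wall of the first factor a, and write the product as a u b q.
    Then a u b = u and q = u^-1 in [W]. Unequal lengths of u and q would give a shorter trivial
    product without equal neighbours, so b sits opposite a. Then u q is a shorter trivial product,
    and it can backtrack only where u meets q, that is, at the neighbours of b. *)
Lemma opposite_neighbours (y : seq W) : size y = n -> y <> [::] -> conj_letters y ->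
  prod y = 1%g -> below_girth n -> cyclically_free y ->
  exists k, [/\ n = (k + k)%N, (2 <= k)%N & nth 1%g y k.-1 = nth 1%g y k.+1].
Proof.
case: y => [//|a y] sy _ X p1 sh /andP[fr la].
have [u [b [q [yE bE]]]] := first_wall_recrossed cs raA X p1; subst y.
have Xu : conj_letters u.
  by apply: conj_letters_sub X => x xu; rewrite inE mem_cat xu orbT.
have Xq : conj_letters q.
  by apply: conj_letters_sub X => x xu; rewrite !(inE, mem_cat) xu !orbT.
have Xa : conj_letter gen A a by apply: X; rewrite mem_head.
have Xb : conj_letter gen A b by apply: X; rewrite !(inE, mem_cat) eqxx !orbT.
have aa := conj_letter_sq cs Xa; have bb := conj_letter_sq cs Xb.
move: sy fr la; rewrite /= size_cat /= last_cat /= => sy fr la.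
have [frl frr] : adjacent_free (a :: u ++ [:: b]) /\ adjacent_free (b :: q).
  split; last by case: (@adjacent_free_cat _ (a :: u) _ fr).
  by move: fr; rewrite -cat1s catA -cat1s => /(@adjacent_free_cat _ (a :: u ++ [:: b]))[].
have pu : (a * prod u * b = prod u)%g.
  by rewrite bE conjgE !mulgA mulgK aa mul1g.
have pq : (prod q = (prod u)^-1)%g.
  apply/esym/mulg1_eq; move: p1; rewrite big_cons big_cat /= big_cons.
  by rewrite !mulgA pu.
have [lt|lt|eq] := ltngtP (size u) (size q).
(* If u is the shorter side, a u b u^-1 is a trivial product shorter than [y]; it inherits from a u
   b that neighbours differ. *)
- have z1 : ~~ adjacent_free ((a :: u) ++ b :: rev u).
    apply: IH => //.
    + by rewrite size_cat /= size_rev; lia.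
    + move=> x; rewrite mem_cat !inE mem_rev.
      by move=> /orP[/predU1P[->|/Xu]|/predU1P[->|/Xu]].
    + by rewrite big_cat /= !big_cons (prod_rev cs Xu) mulgA pu mulgV.
    + by apply: below_girth_le sh; rewrite size_cat /= size_rev; lia.
  case/negP: z1; apply: adjacent_free_join => //.
  rewrite -adjacent_free_rev rev_cons revK -cats1.
  by case: (@adjacent_free_cat _ [:: a] _ frl).
(* Symmetrically with b q a q^-1; that the last term of b q differs from a comes from cyclic
   freeness. *)
- have z1 : ~~ adjacent_free ((b :: q) ++ a :: rev q).
    apply: IH => //.
    + by rewrite size_cat /= size_rev; lia.
    + move=> x; rewrite mem_cat !inE mem_rev.
      by move=> /orP[/predU1P[->|/Xq]|/predU1P[->|/Xq]].
    + rewrite big_cat /= !big_cons (prod_rev cs Xq) pq invgK -mulgA.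
      by rewrite [X in (_ * X)%g](_ : _ = b) // bE conjgE.
    + by apply: below_girth_le sh; rewrite size_cat /= size_rev; lia.
  have frq : adjacent_free ((b :: q) ++ [:: a]).
    by move: frr; rewrite /adjacent_free /= cat_path /= la => ->.
  case/negP: z1; apply: adjacent_free_join => //.
  rewrite -adjacent_free_rev rev_cons revK -cats1.
  by case: (@adjacent_free_cat _ [:: b] _ frq).
case: (lastP u) eq frl pq pu sy fr Xu {bE X p1} => [|u' c] eq frl pq pu sy fr Xu.
  move: pu; rewrite big_nil mulg1 => ab.
  move: frl; rewrite /adjacent_free /= andbT => /negP[]; apply/eqP.
  by apply: (mulIg b); rewrite ab bb.
move: eq sy; rewrite size_rcons.
case: q fr pq frr la Xq => [//|d q] fr pq frr la Xq [eq] /= sy.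
have z1 : ~~ adjacent_free (rcons u' c ++ d :: q).
  apply: IH => //.
  + by rewrite size_cat size_rcons /=; lia.
  + by move/(congr1 size); rewrite size_cat size_rcons.
  + by move=> x; rewrite mem_cat => /orP[/Xu|/Xq].
  + by rewrite big_cat /= pq mulgV.
  + by apply: below_girth_le sh; rewrite size_cat size_rcons /=; lia.
have cd : c = d.
  apply/eqP/negPn/negP => cd; case/negP: z1.
  rewrite cat_rcons; apply: adjacent_free_join.
    move: frl; rewrite -cats1 => /(@adjacent_free_cat _ (a :: u' ++ [:: c]))[].
    by move=> /(@adjacent_free_cat _ [:: a])[].
  by move: frr; rewrite /adjacent_free /= cd => /andP[].
exists (size u').+2; split=> //; first by lia.
rewrite /= cat_rcons nth_cat /= ltnn subnn /= nth_cat ltnNge ltnW //=.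
by rewrite (_ : (size u').+2 - size u' = 2)%N; [rewrite cd|lia].
Qed.

Lemma cyclically_free_rot j y : cyclically_free y -> cyclically_free (rot j y).
Proof.
have [jy|jy] := leqP (size y) j; first by rewrite rot_oversize.
rewrite /rot -{1}(cat_take_drop j y).
case dE: (drop j y) => [|d q]; first by have := size_drop j y; rewrite dE /=; lia.
case: (take j y) => [|a p]; first by rewrite cats0.
rewrite /= last_cat /= => /andP[fr la].
have [fr1 fr2] : adjacent_free (a :: p) /\ adjacent_free (d :: q).
  exact: (@adjacent_free_cat _ (a :: p)) fr.
move: fr fr1 fr2; rewrite /adjacent_free /= !cat_path /= !last_cat /=.
by move=> /and3P[-> h _] _ ->; rewrite la andbT /=.
Qed.

End Step.

(** A shortest counterexample is cyclically free. Applying [opposite_neighbours] to all its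
    rotations shows that terms two places apart agree, so it reads a b a b ... and (a b)^k = 1 with
    2k its length; [conj_letters_order] then contradicts the girth bound. *)
Lemma short_loop_backtracks (y : seq W) : y <> [::] -> conj_letters y -> prod y = 1%g ->
  below_girth (size y) -> ~~ adjacent_free y.
Proof.
have [n le] := ubnP (size y); elim: n y le => [//|n IH'] y le y0 X p1 sh.
have IH : forall z : seq W, (size z < size y)%N -> z <> [::] -> conj_letters z ->
    prod z = 1%g -> below_girth (size z) -> ~~ adjacent_free z.
  by move=> z zy; apply: IH'; lia.
apply/negP => fr.
(* If the first and last factors agree, removing both conjugates the product and leaves a shorter
   counterexample. *)
have cf : cyclically_free y.
  case: y y0 X p1 sh fr IH {le} => [//|a y] _ X p1 sh fr IH.
  rewrite /cyclically_free fr /=; apply/eqP => la.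
  case: (lastP y) la X p1 sh fr IH => [_ X p1 _ _ _|z c].
    by have [[|? ?] [? [? []]]] := first_wall_recrossed cs raA X p1.
  rewrite last_rcons => -> X p1 sh fr IH.
  have fz : adjacent_free z.
    move: fr; rewrite -cats1 -cat1s => /(@adjacent_free_cat _ [:: a])[_].
    by case/adjacent_free_cat.
  have zz : z <> [::] by move=> z0; move: fr; rewrite z0 /adjacent_free /= eqxx.
  have : ~~ adjacent_free z; last by rewrite fz.
  apply: IH => //; first by rewrite /= size_rcons; lia.
  - by apply: conj_letters_sub X => x xz; rewrite inE mem_rcons inE xz !orbT.
  - have aa := conj_letter_sq cs (X _ (mem_head _ _)).
    move: p1; rewrite big_cons -cats1 big_cat /= big_seq1 => h.
    by apply: (mulgI a); apply: (mulIg a); rewrite -mulgA h mulg1 aa.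
  - by apply: below_girth_le sh; rewrite /= size_rcons; lia.
have [k [nk k2 _]] := opposite_neighbours IH erefl y0 X p1 sh cf.
have alt i : (i.+2 < size y)%N -> nth 1%g y i = nth 1%g y i.+2.
  (* Rotating by i - (k-1) modulo 2k brings places i and i+2 to k-1 and k+1. *)
  move=> iy; pose j := (if k.-1 <= i then i - k.-1 else i + k + 1)%N.
  have jy : (j <= size y)%N by rewrite /j; case: ifP; lia.
  have [//||||//||k' [nk' _]] := @opposite_neighbours _ IH (rot j y).
  - exact: size_rot.
  - by move=> r0; apply: y0; apply: size0nil; rewrite -(size_rot j) r0.
  - by apply: conj_letters_sub X => x; rewrite mem_rot.
  - exact: prod_rot.
  - exact: cyclically_free_rot.
  have -> : k' = k by lia.
  have h1 : (k.-1 < size y)%N by lia.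
  have h2 : (k.+1 < size y)%N by lia.
  rewrite (nth_rot _ jy h1) (nth_rot _ jy h2).
  rewrite (_ : (if _ then _ else _) = i); last by rewrite /j; do 2 case: ifP; lia.
  by rewrite (_ : (if _ then _ else _) = i.+2) // /j; do 2 case: ifP; lia.
have y1 : (1 < size y)%N by lia.
have := alternating_prod nk alt (ltnW k2) erefl erefl; rewrite p1.
have := X _ (mem_nth 1%g (ltnW y1)); have := X _ (mem_nth 1%g y1).
move=> [c [h [cA ho cE]]] [b [g [bA go bE]]]; rewrite bE cE => /esym xyk.
have [|bc [l mE lk]] := conj_letters_order cs raA bA cA go ho _ (ltnW k2) xyk.
  rewrite -bE -cE => -[_ e]; move: fr; rewrite /adjacent_free.
  by case: (y) y1 e => [//|? [//|? ?]] _ /= ->; rewrite eqxx.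
by have := sh _ _ _ bA cA bc mE; lia.
Qed.
End ShortLoops.

(** * Reducing short loops by cancellations and commutations *)

Lemma adjacent_free_map (T T' : eqType) (f : T -> T') r :
  {in r &, injective f} -> adjacent_free (map f r) = adjacent_free r.
Proof.
rewrite /adjacent_free; elim: r => //= s [//|t r] IH fI /=.
rewrite (inj_in_eq fI) ?inE ?eqxx ?orbT //=; congr (_ && _).
by apply: IH => x y xr yr; apply: fI; rewrite inE ?xr ?yr orbT.
Qed.

(** * Cancellations and commutations of letters *)

Section Moves.
Variables (W : groupType) (S : finType) (gen : S -> W).
Local Notation val := (word_val gen).

(** These are backtracking along an edge and pushing across a square; the condition on [s], [t] is
    that of [square_dart]. *)
Inductive elementary_move : seq S -> seq S -> Prop :=
| move_cancel p s q : elementary_move (p ++ s :: s :: q) (p ++ q)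
| move_swap p s t q : s != t -> (gen s * gen t = gen t * gen s)%g ->
    elementary_move (p ++ s :: t :: q) (p ++ t :: s :: q).

Definition move_eq := clos_refl_sym_trans (seq S) elementary_move.

Lemma move_eq_ctx p q u v : move_eq u v -> move_eq (p ++ u ++ q) (p ++ v ++ q).
Proof.
elim=> {u v} [u v h|u|u v _|u v w _ IH1 _ IH2].
- apply: rst_step; case: h => [p' s q'|p' s t q' st c].
    by have := move_cancel (p ++ p') s (q' ++ q); rewrite -!catA.
  by have := @move_swap (p ++ p') s t (q' ++ q) st c; rewrite -!catA.
- exact: rst_refl.
- exact: rst_sym.
- exact: rst_trans IH1 IH2.
Qed.

Lemma move_eq_catl p u v : move_eq u v -> move_eq (p ++ u) (p ++ v).
Proof. by move=> /(move_eq_ctx p [::]); rewrite !cats0. Qed.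

Lemma move_eq_catr q u v : move_eq u v -> move_eq (u ++ q) (v ++ q).
Proof. exact: (@move_eq_ctx [::]). Qed.

Lemma move_eq_rev u : move_eq (u ++ rev u) [::].
Proof.
elim: u => [|s u IH]; first exact: rst_refl.
rewrite rev_cons -cats1 -[_ ++ _]/([:: s] ++ u ++ rev u ++ [:: s]).
rewrite [u ++ _]catA; apply: rst_trans (move_eq_ctx _ _ IH) _.
exact: rst_step (@move_cancel [::] s [::]).
Qed.

(** The word v u is equivalent to v (u v) v^-1, hence to v v^-1. *)
Lemma move_eq_rot u v : move_eq (u ++ v) [::] -> move_eq (v ++ u) [::].
Proof.
move=> h; apply: rst_trans (move_eq_rev v).
apply: rst_trans (_ : move_eq _ (v ++ (u ++ v) ++ rev v)) _.
  rewrite -[v ++ u]cats0 -!catA !catA -!catA; apply/move_eq_catl/move_eq_catl.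
  by apply: rst_sym; exact: move_eq_rev.
by rewrite -[v ++ rev v]/(v ++ [::] ++ rev v); exact: move_eq_ctx.
Qed.
End Moves.

(** * The reflections read off a word *)

Section ConjSeq.
Variables (W : groupType) (S : finType) (gen : S -> W).
Variables (m : S -> S -> option nat).
Local Notation val := (word_val gen).
Hypothesis cs : coxeter_system gen m.
Variable A : {set S}.
Hypothesis raA : forall s t, s \in A -> t \notin A ->
  m s t = Some 2%N \/ m s t = None.
Local Notation out g := (all (fun s => s \notin A) g).

(* The letters of [w] in [A], each conjugated by the product of the preceding
   letters outside [A]; [h] holds these, in reverse order. *)
Fixpoint conj_seq (h w : seq S) : seq W :=
  if w is s :: w' then
    if s \in A then (gen s ^ val h)%g :: conj_seq h w' else conj_seq (s :: h) w'
  else [::].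

(** The conjugators telescope. For empty [h] this factors [w] into its [A]-reflections and its image
    under the retraction. *)
Lemma conj_seq_prod h w :
  (\prod_(x <- conj_seq h w) x * (val h)^-1 * val [seq s <- w | s \notin A]
   = (val h)^-1 * val w)%g.
Proof.
elim: w h => [|s w IH] h; first by rewrite big_nil mul1g.
rewrite /= word_val_cons; case: ifP => sA /=.
  have := IH h; rewrite big_cons -!mulgA => ->.
  by rewrite mulVKg.
by have := IH (s :: h); rewrite !word_val_cons invgM (genV cs) !mulgA.
Qed.

Lemma conj_seq_size h w : size (conj_seq h w) = letters_in A w.
Proof.
rewrite /letters_in.
by elim: w h => //= s w IH h; case: ifP => sA /=; rewrite IH.
Qed.

Lemma conj_seq_letters h w : out h ->
  forall x, x \in conj_seq h w -> conj_letter gen A x.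
Proof.
elim: w h => //= s w IH h ho x; case: ifP => sA.
  by rewrite inE => /predU1P[->|/(IH _ ho)//]; exists s, h.
by apply: IH; rewrite /= sA.
Qed.

Lemma conj_seq_head h w x y : conj_seq h w = x :: y ->
  exists r c q, [/\ w = r ++ c :: q, out r, c \in A &
    x = (gen c ^ val (rev r ++ h))%g].
Proof.
elim: w h => //= s w IH h; case: ifP => sA.
  by case=> <- _; exists [::], s, w.
move=> /IH[r [c [q [-> ro cA ->]]]]; exists (s :: r), c, q.
by rewrite /= sA ro rev_cons cat_rcons.
Qed.

(** Equal consecutive reflections come from two letters of [A] separated by a word [r] outside [A].
    The letters coincide by [conj_letter_inj], and cancelling the common conjugator shows that [r]
    commutes with them. *)
Lemma conj_seq_adjacent h w : out h -> ~~ adjacent_free (conj_seq h w) ->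
  exists p b r q, [/\ w = p ++ b :: r ++ b :: q, b \in A, out r &
    (gen b * val r = val r * gen b)%g].
Proof.
elim: w h => //= s w IH h ho; case: ifP => sA; last first.
  have sho : out (s :: h) by rewrite /= sA.
  move=> /(IH _ sho)[p [b [r [q [-> bA ro br]]]]].
  by exists (s :: p), b, r, q.
have IH' : ~~ adjacent_free (conj_seq h w) -> exists p b r q,
    [/\ s :: w = p ++ b :: r ++ b :: q, b \in A, out r &
      (gen b * val r = val r * gen b)%g].
  move=> /(IH _ ho)[p [b [r [q [-> bA ro br]]]]].
  by exists (s :: p), b, r, q.
case E: (conj_seq h w) IH' => [//|x y] IH'.
rewrite /adjacent_free /= negb_and negbK => /orP[/eqP e|/IH'//].
have [r [c [q [wE ro cA xE]]]] := conj_seq_head E.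
move: e; rewrite xE => e.
have so : out (rev r ++ h) by rewrite all_cat all_rev ro.
have sc := conj_letter_inj cs raA sA cA ho so e.
exists [::], s, r, q; split=> //; first by rewrite wE -sc.
move: e; rewrite -sc word_val_cat conjgM (word_val_rev cs) => /conjg_inj.
by rewrite conjgE invgK => {1}->; rewrite -!mulgA mulVg mulg1.
Qed.

Lemma conj_seq_trivial w : val w = 1%g -> (\prod_(x <- conj_seq [::] w) x = 1)%g.
Proof.
move=> w1; have := conj_seq_prod [::] w.
have /(retraction cs raA) -> /= : coxeter_eq m w [::].
  by case: cs => _ _ <-; rewrite w1 word_val_nil.
by rewrite w1 !word_val_nil invg1 !mulg1.
Qed.

Lemma short_word_pinch w : val w = 1%g -> (0 < letters_in A w)%N ->
  below_girth m A (letters_in A w) ->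
  exists p b r q, [/\ w = p ++ b :: r ++ b :: q, b \in A, out r &
    (gen b * val r = val r * gen b)%g].
Proof.
move=> w1 w0 sh; apply: (@conj_seq_adjacent [::]) => //.
apply: (short_loop_backtracks cs raA).
- by move=> e; rewrite -(conj_seq_size [::]) e in w0.
- exact: conj_seq_letters.
- exact: conj_seq_trivial.
- by rewrite conj_seq_size.
Qed.

(** The trivial word b r b r^-1 has 2|r| reflections: the letters of r conjugated by b, then those
    of r^-1. Two neighbours agree, and for reduced r this can happen only in the middle. So the last
    letter of r commutes with b, and b moves past it. *)
Lemma commuting_letter_moves b r : b \notin A -> {subset r <= A} ->
  below_girth m A (2 * size r) -> (gen b * val r = val r * gen b)%g ->
  move_eq gen (b :: r ++ [:: b]) r.
Proof.
move=> bA; have [n le] := ubnP (size r); elim: n r le => // n IH r le rA sh br.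
have [->|r0] := eqVneq r [::]; first exact: rst_step (@move_cancel _ _ _ [::] b [::]).
(* When [r] contains a repeated letter, that pair is cancelled on both sides of the equivalence
   first. *)
have [fr|/adjacent_freePn[p [s [q rE]]]] := boolP (adjacent_free r); last first.
  have rr' : move_eq gen r (p ++ q) by rewrite rE; exact/rst_step/move_cancel.
  apply: rst_trans (rst_sym _ _ _ _ rr').
  apply: rst_trans (move_eq_ctx [:: b] [:: b] rr') _.
  apply: IH.
  - by move: le; rewrite rE !size_cat /=; lia.
  - by move=> x; rewrite mem_cat => /orP[] xr; apply: rA;
      rewrite rE !(inE, mem_cat) xr ?orbT.
  - by apply: below_girth_le sh; rewrite rE !size_cat /=; lia.
  - move: br; rewrite rE !word_val_cat !word_val_cons.
    by rewrite -{1 3}(genV cs s) mulKg.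
have h1 : ~~ adjacent_free (map (fun s => (gen s ^ gen b)%g) r ++ map gen (rev r)).
  apply: (short_loop_backtracks cs raA).
  - by case: (r) r0.
  - move=> x; rewrite mem_cat => /orP[] /mapP[s].
      move=> /rA sA ->; exists s, [:: b].
      by rewrite /= bA sA word_val_cons word_val_nil mulg1.
    rewrite mem_rev => /rA sA ->; exists s, [::].
    by rewrite sA word_val_nil conjg1.
  - rewrite big_cat /= !big_map -conjg_prod.
    rewrite -/(val r) -/(val (rev r)).
    by rewrite (word_val_rev cs) conjgE -br mulKg mulgV.
  - by rewrite size_cat !size_map size_rev addnn -mul2n.
case: (lastP r) r0 rA le sh br fr h1 => [//|r' c] _ rA le sh br fr h1.
have cA : c \in A by apply: rA; rewrite mem_rcons mem_head.
have bc : (gen c ^ gen b = gen c)%g.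
  apply/eqP/negPn/negP => ne; case/negP: h1.
  have gI : {in rcons r' c &, injective gen}.
    by move=> x y /rA xA /rA yA; exact: (gen_inj cs raA).
  rewrite rev_rcons map_rcons cat_rcons; apply: adjacent_free_join.
    rewrite cats1 -map_rcons adjacent_free_map // => x y xr yr /conjg_inj.
    exact: gI.
  move: fr; rewrite -(adjacent_free_map gI) -adjacent_free_rev -map_rev rev_rcons.
  by rewrite /adjacent_free /= ne.
have bc' : (gen b * gen c = gen c * gen b)%g.
  by rewrite -{1}bc conjgE (genV cs) !mulgA (gen_sq cs) mul1g.
have br' : (gen b * val r' = val r' * gen b)%g.
  apply: (mulIg (gen c)); move: br; rewrite -cats1 !word_val_cat word_val_cons.
  by rewrite word_val_nil mulg1 -!mulgA bc'.
apply: (@rst_trans _ _ _ ((b :: r' ++ [:: b]) ++ [:: c])).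
  rewrite (_ : b :: rcons r' c ++ [:: b] = (b :: r') ++ [:: c; b]); last first.
    by rewrite cat_rcons.
  rewrite (_ : (b :: r' ++ [:: b]) ++ [:: c] = (b :: r') ++ [:: b; c]); last first.
    by rewrite /= -catA.
  apply/rst_step/move_swap; last by rewrite bc'.
  by apply: contraNneq bA => <-.
rewrite -[X in clos_refl_sym_trans _ _ _ X]cats1; apply: move_eq_catr; apply: IH => //.
- by move: le; rewrite size_rcons; lia.
- by move=> x xr; apply: rA; rewrite mem_rcons inE xr orbT.
- by apply: below_girth_le sh; rewrite size_rcons; lia.
Qed.
End ConjSeq.

Lemma suffix_after (T : eqType) (Z r p : seq T) b q :
  Z ++ r = p ++ b :: q -> b \notin r -> exists q', q = q' ++ r.
Proof.
elim: Z p => [|z Z IH] [|x p] /=.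
- by move=> ->; rewrite mem_head.
- by move=> ->; rewrite inE mem_cat mem_head !orbT.
- by case=> _ <- _; exists Z.
- by case=> _; exact: IH.
Qed.

(** * Reduction of short loops in two colours *)

Section Main.
Variables (W : groupType) (S : finType) (gen : S -> W).
Variables (m : S -> S -> option nat).
Local Notation val := (word_val gen).
Hypothesis cs : coxeter_system gen m.
Variables A B : {set S}.
Hypothesis ra : right_angled_partition m A B.

Lemma partition_notin s : (s \in B) = (s \notin A).
Proof.
case: ra => /setP/(_ s) + /setP/(_ s) + _; rewrite !inE.
by case: (s \in A); case: (s \in B).
Qed.

Lemma ra_left s t : s \in A -> t \notin A -> m s t = Some 2%N \/ m s t = None.
Proof. by rewrite -partition_notin; case: ra => _ _; apply. Qed.

Lemma ra_right s t : s \in B -> t \notin B -> m s t = Some 2%N \/ m s t = None.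
Proof.
move=> sB; rewrite partition_notin negbK (m_sym cs) => tA.
by case: ra => _ _; apply.
Qed.

(** By induction on the length, pairs of letters of [B] are removed first; once none is left, [w] is
    itself a trivial product of letters of [A] and contains a cancellation. *)
Lemma short_loop_moves w : val w = 1%g ->
  below_girth m A (letters_in A w) -> below_girth m B (letters_in B w) ->
  move_eq gen w [::].
Proof.
have [n le] := ubnP (size w); elim: n w le => // n IH w le w1 shA shB.
have [w0|w0] := posnP (letters_in B w); last first.
  (* A pinched pair [b r b] whose gap has at most half of the letters of [A] is replaced by [r],
     which shortens the word by two. *)
  have reduce p b r q : size (p ++ b :: r ++ b :: q) = size w ->
      letters_in A (p ++ b :: r ++ b :: q) = letters_in A w ->
      letters_in B (p ++ b :: r ++ b :: q) = letters_in B w ->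
      val (p ++ b :: r ++ b :: q) = 1%g -> b \in B ->
      all (fun s => s \notin B) r -> (gen b * val r = val r * gen b)%g ->
      (2 * size r <= letters_in A w)%N -> move_eq gen (p ++ b :: r ++ b :: q) [::].
    move=> sw aw bw vw bB ro br lr.
    have -> : p ++ b :: r ++ b :: q = p ++ (b :: r ++ [:: b]) ++ q.
      by rewrite /= -catA.
    have brb : move_eq gen (b :: r ++ [:: b]) r.
      apply: (commuting_letter_moves cs ra_left) => //.
      - by rewrite -partition_notin.
      - by move=> s /(allP ro); rewrite partition_notin negbK.
      - exact: below_girth_le shA.
    apply: rst_trans (move_eq_ctx p q brb) _; apply: IH.
    - by move: le; rewrite -sw !size_cat /= size_cat /=; lia.
    - move: vw; rewrite !(word_val_cat, word_val_cons) => <-; congr (_ * _)%g.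
      by rewrite !mulgA br -[(_ * gen b * gen b)%g]mulgA (gen_sq cs) mulg1.
    - apply: below_girth_le shA; rewrite -aw /letters_in !count_cat /= count_cat /=.
      lia.
    - apply: below_girth_le shB; rewrite -bw /letters_in !count_cat /= count_cat /=.
      lia.
  have [p [b [r [q [wE bB ro br]]]]] := short_word_pinch cs ra_right w1 w0 shB.
  have [lr|lr] := leqP (2 * size r) (letters_in A w).
    by rewrite wE; apply: reduce; rewrite -?wE.
  (* After rotating the long gap [r] to the end, the next pinched gap is short. *)
  pose w' := (b :: q) ++ p ++ (b :: r).
  have perm : perm_eq w' w.
    by rewrite /w' wE perm_catC -catA.
  have lA : letters_in A w' = letters_in A w by exact/permP.
  have lB : letters_in B w' = letters_in B w by exact/permP.
  have sz : size w' = size w by exact: perm_size.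
  have w'1 : val w' = 1%g.
    rewrite /w' word_val_cat; apply: (mulIg (val (b :: q))).
    rewrite mul1g -mulgA -word_val_cat -catA.
    by rewrite -[(b :: r) ++ _]/(b :: r ++ b :: q) -wE w1 mulg1.
  have red' : move_eq gen w' [::].
    have [||p1 [b1 [r1 [q1 [w'E b1B r1o b1r1]]]]] := short_word_pinch cs ra_right w'1.
    - by rewrite lB.
    - by rewrite lB.
    rewrite w'E; apply: reduce => //; rewrite -?w'E //.
    (* The letter [b1] lies in [B] and does not occur in [r], so the second pinched pair ends before
       the final [r]. *)
    have [||q' q1E] := @suffix_after _ (b :: q ++ p ++ [:: b]) r (p1 ++ b1 :: r1) b1 q1.
    - by rewrite -!catA /= -catA -w'E /w' /= -!catA.
    - by apply/negP => /(allP ro); rewrite b1B.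
    have cA v : all (fun s => s \notin B) v -> letters_in A v = size v.
      move=> /allP vB; apply/eqP; rewrite -all_count; apply/allP => s /vB.
      by rewrite partition_notin negbK.
    (* The gaps [r1] and [r] are disjoint, and [r] has more than half of the letters of [A]; so [r1]
       has less than half. *)
    have : letters_in A (p1 ++ b1 :: r1 ++ b1 :: q' ++ r) = letters_in A w.
      by rewrite -lA w'E q1E.
    rewrite -[_ ++ _]/(p1 ++ [:: b1] ++ r1 ++ [:: b1] ++ q' ++ r).
    rewrite /letters_in !count_cat -!/(letters_in _ _) (cA r1) // (cA r) //.
    by move: lr; lia.
  have : move_eq gen ((p ++ b :: r) ++ b :: q) [::] by exact: move_eq_rot.
  by rewrite -catA -wE.
have wA : {subset w <= A}.
  move=> s sw; apply/negPn; rewrite -partition_notin; apply/negP => sB.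
  have : has (fun s => s \in B) w by apply/hasP; exists s.
  by rewrite has_count -/(letters_in B w) w0.
have [->|wn] := eqVneq w [::]; first exact: rst_refl.
have : ~~ adjacent_free w.
  rewrite -(@adjacent_free_map _ _ gen w); last first.
    by move=> x y /wA xA /wA yA; exact: (gen_inj cs ra_left).
  apply: (short_loop_backtracks cs ra_left).
  - by case: (w) wn.
  - move=> x /mapP[s /wA sA ->]; exists s, [::].
    by rewrite sA word_val_nil conjg1.
  - by rewrite big_map.
  - rewrite size_map (_ : size w = letters_in A w) //.
    by apply/esym/eqP; rewrite -all_count; apply/allP.
move=> /adjacent_freePn[p [s [q wE]]]; rewrite wE.
apply: rst_trans (rst_step _ _ _ _ (move_cancel _ p s q)) _; apply: IH.
- by move: le; rewrite wE !size_cat /=; lia.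
- by move: w1; rewrite wE !(word_val_cat, word_val_cons) -{1}(genV cs s) mulKg.
- by apply: below_girth_le shA; rewrite wE /letters_in !count_cat /=; lia.
- by apply: below_girth_le shB; rewrite wE /letters_in !count_cat /=; lia.
Qed.
End Main.

(** * Homotopies in the Cayley complex *)

Local Open Scope classical_set_scope.
Local Open Scope ring_scope.

Lemma continuous_compose (T U V : topologicalType) (f : T -> U) (g : U -> V) :
  continuous f -> continuous g -> continuous (fun x => g (f x)).
Proof. by move=> cf cg x; apply: (@continuous_comp _ _ _ f g); [exact: cf|exact: cg]. Qed.

Lemma continuous_pair (T U V : topologicalType) (f : T -> U) (g : T -> V) :
  continuous f -> continuous g -> continuous (fun x => (f x, g x)).
Proof. by move=> cf cg x; apply: cvg_pair; [exact: cf|exact: cg]. Qed.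

Lemma continuous_fst (T U : topologicalType) : continuous (@fst T U).
Proof. by move=> x; exact: cvg_fst. Qed.

Lemma continuous_snd (T U : topologicalType) : continuous (@snd T U).
Proof. by move=> x; exact: cvg_snd. Qed.

Lemma continuous_cst (T U : topologicalType) (c : U) : continuous (fun _ : T => c).
Proof. by move=> x; exact: cvg_cst. Qed.

(** * Real-valued formulas and pasting on the unit interval *)

Section Interval.
Variable R : realType.

Section Arith.
Variables (T : topologicalType) (f g : T -> R).
Hypotheses (cf : continuous f) (cg : continuous g).

Lemma continuous_minr : continuous (fun x => Num.min (f x) (g x)).
Proof. exact: continuous_compose (continuous_pair cf cg) (@min_continuous _ R). Qed.

Lemma continuous_maxr : continuous (fun x => Num.max (f x) (g x)).
Proof. exact: continuous_compose (continuous_pair cf cg) (@max_continuous _ R). Qed.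

Lemma continuous_addr : continuous (fun x => f x + g x).
Proof. by move=> x; apply: cvgD; [exact: cf|exact: cg]. Qed.

Lemma continuous_subr : continuous (fun x => f x - g x).
Proof. by move=> x; apply: cvgB; [exact: cf|exact: cg]. Qed.

Lemma continuous_mulr : continuous (fun x => f x * g x).
Proof. by move=> x; apply: cvgM; [exact: cf|exact: cg]. Qed.
End Arith.

Lemma val01_continuous : continuous (@val01 R).
Proof. exact: initial_continuous. Qed.

Lemma clamp01_continuous : continuous (@clamp01 R).
Proof.
apply: continuous_comp_initial.
have h : continuous (fun x : R => Num.max 0 (Num.min x 1)).
  apply: continuous_maxr; first exact: continuous_cst.
  apply: continuous_minr; last exact: continuous_cst.
  by move=> x; exact: cvg_id.
exact: h.
Qed.

Lemma val_clamp01 (x : R) : 0 <= x <= 1 -> val01 (clamp01 x) = x.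
Proof. by move=> /andP[x0 x1]; rewrite /val01 /= min_l // max_r. Qed.

Lemma clamp01_le0 (x : R) : x <= 0 -> clamp01 x = clamp01 0.
Proof.
move=> x0; apply: val_inj => /=.
by rewrite (min_l ler01) !max_l // ge_min x0.
Qed.

Lemma clamp01_ge1 (x : R) : 1 <= x -> clamp01 x = clamp01 1.
Proof. by move=> x1; apply: val_inj => /=; rewrite !min_r. Qed.

Lemma val01_ge0 (t : I01 R) : 0 <= val01 t.
Proof. by case: t => t /= /set_mem; rewrite /= in_itv /= => /andP[]. Qed.

Lemma val01_le1 (t : I01 R) : val01 t <= 1.
Proof. by case: t => t /= /set_mem; rewrite /= in_itv /= => /andP[]. Qed.

Lemma val_clamp01_0 : val01 (clamp01 (0 : R)) = 0.
Proof. by rewrite val_clamp01 // lexx ler01. Qed.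

Lemma val_clamp01_1 : val01 (clamp01 (1 : R)) = 1.
Proof. by rewrite val_clamp01 // lexx ler01. Qed.

Lemma clamp01_opp (x x' : R) : x' = 1 - x ->
  val01 (clamp01 x') = 1 - val01 (clamp01 x).
Proof.
move=> ->; rewrite /val01 /=; case: (lerP x 1) => x1; case: (lerP (1 - x) 1) => x0;
  rewrite ?maxEle ?minEle; do ! case: ifP; lra.
Qed.

Lemma paste_continuous (T X : topologicalType) (phi : T -> R) (c : R)
    (F G : T -> X) : continuous phi -> continuous F -> continuous G ->
  (forall p, phi p = c -> F p = G p) ->
  continuous (fun p => if phi p <= c then F p else G p).
Proof.
move=> cphi cF cG FG p U /=; case: (ltgtP (phi p) c) => [lt|gt|eq] UU.
- have : \forall q \near p, phi q < c /\ U (F q).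
    apply: filterI; last exact: (cF p _ UU).
    exact: (cphi p _ (lt_nbhsl lt)).
  by apply: filterS => q [/ltW qc Uq] /=; rewrite qc.
- have : \forall q \near p, phi q > c /\ U (G q).
    apply: filterI; last exact: (cG p _ UU).
    exact: (cphi p _ (lt_nbhsr gt)).
  by apply: filterS => q [qc Uq] /=; rewrite leNgt qc.
- have : \forall q \near p, U (F q) /\ U (G q).
    apply: filterI; first exact: (cF p _ UU).
    by apply: (cG p); rewrite -FG.
  by apply: filterS => q [UF UG] /=; case: ifP.
Qed.
End Interval.

#[local] Arguments val01 : simpl never.
#[local] Arguments clamp01 : simpl never.

(** * Edge paths and their homotopies *)

Section Paths.
Variables (R : realType) (W : groupType) (S : finType) (gen : S -> W).
Local Notation X := (cayley_complex R gen).
Hypothesis gen2 : forall s, (gen s * gen s = 1)%g.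

Definition vertex (v : W) : X := cell_proj (vertex_pt R gen v).
(** Clamping makes the path rest at its end vertices outside [0,1], so that the homotopies below may
    overshoot. *)
Definition edge (v : W) (s : S) (x : R) : X :=
  cell_proj (edge_pt gen v s (clamp01 x)).

Lemma cell_proj_glue (p q : cell_sum R gen) : Defs.glue p q -> cell_proj p = cell_proj q.
Proof.
by move=> h; apply/eqmodP; apply/asboolP; exact: rst_step.
Qed.

Lemma cell_proj_continuous : continuous (@cell_proj R W S gen).
Proof. exact: pi_continuous. Qed.

Lemma edge_continuous v s : continuous (edge v s).
Proof.
move=> x; apply: (@continuous_comp _ _ _ (@clamp01 R)
  (fun y => cell_proj (edge_pt gen v s y))); first exact: clamp01_continuous.
apply: (@continuous_comp _ _ _ (edge_pt gen v s)); last exact: cell_proj_continuous.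
exact: (@existT_continuous _ (cell_space R (gen := gen)) (inl (inr (v, s)))).
Qed.

Lemma edge_le0 v s x : x <= 0 -> edge v s x = vertex v.
Proof.
move=> /clamp01_le0 e; rewrite /edge e; apply: cell_proj_glue.
by apply: glue_edge_end; rewrite val_clamp01_0.
Qed.

Lemma edge_flip v s x : edge v s x = edge (v * gen s)%g s (1 - x).
Proof. by apply/cell_proj_glue/glue_edge_flip/clamp01_opp. Qed.

Lemma edge_ge1 v s x : 1 <= x -> edge v s x = vertex (v * gen s)%g.
Proof. by move=> x1; rewrite edge_flip edge_le0 // subr_le0. Qed.


(* Lazy words: [None] waits for one unit of time at the current vertex, so that
   all the words of a derivation can be given the same length. *)
Definition letter_val (o : option S) : W := if o is Some s then gen s else 1%g.

Definition letter_path (v : W) (o : option S) (x : R) : X :=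
  if o is Some s then edge v s x else vertex v.

Fixpoint lazy_walk (v : W) (w : seq (option S)) (x : R) : X :=
  if w is o :: w' then
    if x <= 1 then letter_path v o x
    else lazy_walk (v * letter_val o)%g w' (x - 1)
  else vertex v.

Definition lazy_val (w : seq (option S)) : W := (\prod_(o <- w) letter_val o)%g.

Lemma lazy_val_cons o w : lazy_val (o :: w) = (letter_val o * lazy_val w)%g.
Proof. by rewrite /lazy_val big_cons. Qed.

Lemma letter_path_le0 v o x : x <= 0 -> letter_path v o x = vertex v.
Proof. by case: o => //= s; exact: edge_le0. Qed.

Lemma letter_path_ge1 v o x : 1 <= x ->
  letter_path v o x = vertex (v * letter_val o)%g.
Proof. by case: o => [s|_] /=; [exact: edge_ge1|rewrite mulg1]. Qed.

Lemma letter_path_continuous v o : continuous (letter_path v o).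
Proof. by case: o => [s|]; [exact: edge_continuous|exact: continuous_cst]. Qed.

Lemma lazy_walk_le0 v w x : x <= 0 -> lazy_walk v w x = vertex v.
Proof.
case: w => //= o w x0; rewrite ifT; first exact: letter_path_le0.
exact: le_trans x0 ler01.
Qed.

Lemma lazy_walk_ge v w x : (size w)%:R <= x ->
  lazy_walk v w x = vertex (v * lazy_val w)%g.
Proof.
elim: w v x => [|o w IH] v x /=; first by rewrite /lazy_val big_nil mulg1.
rewrite lazy_val_cons mulgA -natr1 => h; case: ifP => x1; last first.
  by apply: IH; lra.
have : (size w)%:R <= 0 :> R by lra.
rewrite lern0 size_eq0 => /eqP w0.
rewrite letter_path_ge1; last by move: h; rewrite w0 /=; lra.
by rewrite w0 /lazy_val big_nil mulg1.
Qed.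

Lemma lazy_walk_continuous v w : continuous (lazy_walk v w).
Proof.
elim: w v => [|o w IH] v; first exact: continuous_cst.
apply: (@paste_continuous _ _ _ id 1 (letter_path v o)
  (fun x => lazy_walk (v * letter_val o)%g w (x - 1))) => [x|||x ->].
- exact: cvg_id.
- exact: letter_path_continuous.
- apply: continuous_compose (IH _).
  by apply: continuous_subr; [move=> y; exact: cvg_id|exact: continuous_cst].
- by rewrite letter_path_ge1 // lazy_walk_le0 // subrr.
Qed.

(** End points are fixed and the start is arbitrary, so such homotopies can be extended by common
    prefixes. Time runs over the whole line, which makes shifting them easy. *)
Definition lazy_homotopic (w w' : seq (option S)) : Prop :=
  size w = size w' /\ forall v, exists H : R * I01 R -> X,
    [/\ continuous H,
        forall x, H (x, clamp01 0) = lazy_walk v w x,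
        forall x, H (x, clamp01 1) = lazy_walk v w' x,
        forall t, H (0, t) = vertex v &
        forall t, H ((size w)%:R, t) = vertex (v * lazy_val w)%g].

Lemma lazy_homotopic_refl w : lazy_homotopic w w.
Proof.
split=> // v; exists (fun p => lazy_walk v w p.1); split=> //.
- apply: continuous_compose; first exact: continuous_fst.
  exact: lazy_walk_continuous.
- by move=> t /=; rewrite lazy_walk_le0.
- by move=> t /=; rewrite lazy_walk_ge.
Qed.

Lemma lazy_homotopic_sym w w' : lazy_homotopic w w' -> lazy_homotopic w' w.
Proof.
move=> [sw h]; split=> // v; have [H [cH H0 H1 Ha Hb]] := h v.
exists (fun p => H (p.1, clamp01 (1 - val01 p.2))); split.
- apply: continuous_compose cH; apply: continuous_pair; first exact: continuous_fst.
  apply: continuous_compose (@clamp01_continuous R).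
  apply: continuous_subr; first exact: continuous_cst.
  exact: continuous_compose (@continuous_snd _ _) (@val01_continuous R).
- by move=> x; rewrite /= val_clamp01_0 subr0.
- by move=> x; rewrite /= val_clamp01_1 subrr.
- by move=> t /=.
- by move=> t /=; rewrite -sw Hb -(Hb (clamp01 1)) H1 lazy_walk_ge // sw.
Qed.

Lemma lazy_homotopic_trans w1 w2 w3 :
  lazy_homotopic w1 w2 -> lazy_homotopic w2 w3 -> lazy_homotopic w1 w3.
Proof.
move=> [s12 h12] [s23 h23]; split=> [|v]; first by rewrite s12.
have [H [cH H0 H1 Ha Hb]] := h12 v; have [K [cK K0 K1 Ka Kb]] := h23 v.
have c2 : continuous (fun p : R * I01 R => val01 p.2).
  exact: continuous_compose (@continuous_snd _ _) (@val01_continuous R).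
have cc : continuous (fun p : R * I01 R => 2 * val01 p.2).
  by apply: continuous_mulr => //; exact: continuous_cst.
exists (fun p => if val01 p.2 <= 1 / 2 then H (p.1, clamp01 (2 * val01 p.2))
                 else K (p.1, clamp01 (2 * val01 p.2 - 1))); split.
- apply: (@paste_continuous _ _ _ (fun p : R * I01 R => val01 p.2)) => //.
  + apply: continuous_compose cH; apply: continuous_pair; first exact: continuous_fst.
    exact: continuous_compose cc (@clamp01_continuous R).
  + apply: continuous_compose cK; apply: continuous_pair; first exact: continuous_fst.
    apply: continuous_compose (@clamp01_continuous R).
    by apply: continuous_subr => //; exact: continuous_cst.
  + move=> p ->; rewrite mul1r mulfV ?pnatr_eq0 // subrr.
    by rewrite H1 K0.
- by move=> x; rewrite /= val_clamp01_0 mulr0 divr_ge0 // H0.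
- move=> x; rewrite /= val_clamp01_1 mulr1 ifF; last by apply/negP; lra.
  by rewrite (_ : 2 - 1 = 1) ?K1 //; lra.
- by move=> t /=; rewrite Ha Ka; case: ifP.
- move=> t /=; rewrite Hb s12 Kb.
  have -> : vertex (v * lazy_val w2)%g = vertex (v * lazy_val w1)%g; last by case: ifP.
  by rewrite -(Hb (clamp01 1)) H1 lazy_walk_ge // s12.
Qed.

Lemma lazy_homotopic_cons o w w' :
  lazy_homotopic w w' -> lazy_homotopic (o :: w) (o :: w').
Proof.
move=> [sw h]; split=> [|v]; first by rewrite /= sw.
have [H [cH H0 H1 Ha Hb]] := h (v * letter_val o)%g.
exists (fun p => if p.1 <= 1 then letter_path v o p.1 else H (p.1 - 1, p.2)); split.
- apply: (@paste_continuous _ _ _ fst); first exact: continuous_fst.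
  + apply: continuous_compose (@letter_path_continuous _ _).
    exact: continuous_fst.
  + apply: continuous_compose cH; apply: continuous_pair; last exact: continuous_snd.
    by apply: continuous_subr; [exact: continuous_fst|exact: continuous_cst].
  + by move=> [x t] /= ->; rewrite subrr Ha letter_path_ge1.
- by move=> x /=; rewrite H0.
- by move=> x /=; rewrite H1.
- by move=> t /=; rewrite ler01 letter_path_le0.
- move=> t /=; rewrite lazy_val_cons mulgA -natr1 addrK Hb.
  case: ifP => // h1; have : (size w)%:R <= 0 :> R by lra.
  rewrite lern0 size_eq0 => /eqP w0; rewrite letter_path_ge1; last by rewrite w0 /=; lra.
  by rewrite w0 /lazy_val big_nil mulg1.
Qed.

(** A homotopy of two-letter paths is followed from time 2 on by the unchanged walk along [q]. *)
Lemma lazy_homotopic_block a b a' b' q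
    (B : W -> R * I01 R -> X) :
  (forall v, continuous (B v)) ->
  (letter_val a * letter_val b = letter_val a' * letter_val b')%g ->
  (forall v x, B v (x, clamp01 0) = lazy_walk v [:: a; b] x) ->
  (forall v x, B v (x, clamp01 1) = lazy_walk v [:: a'; b'] x) ->
  (forall v t, B v (0, t) = vertex v) ->
  (forall v t, B v (2, t) = vertex (v * letter_val a * letter_val b)%g) ->
  lazy_homotopic (a :: b :: q) (a' :: b' :: q).
Proof.
move=> cB ab B0 B1 Ba Bb; split=> // v.
exists (fun p => if p.1 <= 2 then B v p
  else lazy_walk (v * letter_val a * letter_val b)%g q (p.1 - 2)).
have split2 c d x : (if x <= 2 then lazy_walk v [:: c; d] x else
    lazy_walk (v * letter_val c * letter_val d)%g q (x - 2)) =
    lazy_walk v [:: c, d & q] x.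
  rewrite /=; case: (lerP x 1) => x1; first by rewrite ifT //; lra.
  case: (lerP (x - 1) 1) => x2; first by rewrite ifT //; lra.
  by rewrite ifF; [congr lazy_walk; lra|lra].
split.
- apply: (@paste_continuous _ _ _ fst) => //; first exact: continuous_fst.
  + apply: continuous_compose (@lazy_walk_continuous _ _).
    by apply: continuous_subr; [exact: continuous_fst|exact: continuous_cst].
  + by move=> [x t] /= ->; rewrite subrr Bb lazy_walk_le0.
- by move=> x; rewrite -split2 B0.
- move=> x; rewrite -split2 B1.
  by rewrite (_ : (v * _ * _ = v * letter_val a' * letter_val b')%g) // -!mulgA ab.
- by move=> t; rewrite /= ler0n Ba.
- move=> t; rewrite /= !lazy_val_cons !mulgA; case: ifP => h2; last first.
    by rewrite lazy_walk_ge // -!natr1; lra.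
  have : (size q)%:R <= 0 :> R by move: h2; rewrite -!natr1; lra.
  rewrite lern0 size_eq0 => /eqP ->; rewrite /= Bb.
  by rewrite /lazy_val big_nil mulg1.
Qed.

Lemma lazy_cancel s q :
  lazy_homotopic [:: Some s, Some s & q] [:: None, None & q].
Proof.
(* The tent min(x, 2 - x) runs out along the edge and back. Lowering it by the homotopy parameter
   retracts the path into [v], negative values being clamped. *)
apply: (@lazy_homotopic_block _ _ _ _ _
  (fun v p => edge v s (Num.min p.1 (2 - p.1) - val01 p.2))).
- move=> v; apply: continuous_compose (@edge_continuous v s).
  apply: continuous_subr.
    apply: continuous_minr; first exact: continuous_fst.
    by apply: continuous_subr; [exact: continuous_cst|exact: continuous_fst].
  exact: continuous_compose (@continuous_snd _ _) (@val01_continuous R).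
- by rewrite /= mulg1 gen2.
- move=> v x; rewrite /= val_clamp01_0 subr0.
  case: (lerP x 1) => x1; first by rewrite min_l //; lra.
  rewrite min_r; last by lra.
  case: (lerP (x - 1) 1) => x2.
    by rewrite (edge_flip v s (2 - x)) (_ : 1 - (2 - x) = x - 1) //; lra.
  by rewrite edge_le0; [rewrite -mulgA gen2 mulg1|lra].
- move=> v x; rewrite /= val_clamp01_1 edge_le0; last first.
    by rewrite subr_le0 ge_min; apply/orP; case: (lerP x 1); [left|right]; lra.
  by rewrite !mulg1; rewrite !if_same.
- by move=> v t; rewrite /= edge_le0 // min_l; [have := val01_ge0 t|]; lra.
- move=> v t; rewrite /= edge_le0; last by rewrite min_r; [have := val01_ge0 t|]; lra.
  by rewrite -mulgA gen2 mulg1.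
Qed.

Lemma lazy_wait s q :
  lazy_homotopic [:: None, Some s & q] [:: Some s, None & q].
Proof.
(* The moment at which the edge is entered slides from 1 to 0. *)
apply: (@lazy_homotopic_block _ _ _ _ _
  (fun v p => edge v s (p.1 - 1 + val01 p.2))).
- move=> v; apply: continuous_compose (@edge_continuous v s).
  apply: continuous_addr.
    by apply: continuous_subr; [exact: continuous_fst|exact: continuous_cst].
  exact: continuous_compose (@continuous_snd _ _) (@val01_continuous R).
- by rewrite /= mulg1 mul1g.
- move=> v x; rewrite /= val_clamp01_0 addr0 mulg1.
  case: (lerP x 1) => x1; first by rewrite edge_le0 //; lra.
  by case: (lerP (x - 1) 1) => x2 //; rewrite edge_ge1 //; lra.
- move=> v x; rewrite /= val_clamp01_1 subrK.
  case: (lerP x 1) => x1 //; rewrite edge_ge1; last by lra.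
  by rewrite mulg1; case: ifP.
- by move=> v t; rewrite /= edge_le0 //; have := val01_le1 t; lra.
- by move=> v t; rewrite /= mulg1 edge_ge1 //; have := val01_ge0 t; lra.
Qed.

(** * Homotopies across squares *)

Definition square v s t (h : square_dart gen (v, s, t)) (x y : R) : X :=
  cell_proj (square_pt h (clamp01 x) (clamp01 y)).

Lemma square_continuous v s t (h : square_dart gen (v, s, t)) :
  continuous (fun p => square h p.1 p.2).
Proof.
apply: (@continuous_compose _ _ _
  (fun p : R * R => existT (cell_space R (gen := gen)) (inr (exist _ (v, s, t) h))
     (clamp01 p.1, clamp01 p.2))); last exact: cell_proj_continuous.
apply: (@continuous_compose _ (I01 R * I01 R)%type _
  (fun p : R * R => (clamp01 p.1, clamp01 p.2))); last first.
  exact: (@existT_continuous _ (cell_space R (gen := gen)) (inr (exist _ (v, s, t) h))).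
apply: continuous_pair; apply: continuous_compose (@clamp01_continuous R).
  exact: continuous_fst.
exact: continuous_snd.
Qed.

Lemma square_dart_swap v s t : square_dart gen (v, s, t) -> square_dart gen (v, t, s).
Proof. by rewrite /= eq_sym => /andP[-> /eqP->] /=. Qed.

Lemma square_dart_move v u s t : square_dart gen (v, s, t) -> square_dart gen (u, s, t).
Proof. by []. Qed.

Lemma square_swap v s t (h : square_dart gen (v, s, t)) x y :
  square h x y = square (square_dart_swap h) y x.
Proof. exact/cell_proj_glue/glue_square_swap. Qed.

Lemma square_side v s t (h : square_dart gen (v, s, t)) x y : y <= 0 ->
  square h x y = edge v s x.
Proof.
move=> /clamp01_le0 e; rewrite /square e.
by apply/cell_proj_glue/glue_square_side; rewrite val_clamp01_0.
Qed.

(** Flipping the first direction moves the corner to v s; after a swap the far side is a base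
    side. *)
Lemma square_far_side v s t (h : square_dart gen (v, s, t)) x y : 1 <= x ->
  square h x y = edge (v * gen s)%g t y.
Proof.
move=> x1; have h' := square_dart_move (v * gen s)%g h.
have -> : square h x y = square h' (1 - x) y.
  exact/cell_proj_glue/glue_square_flip/clamp01_opp.
by rewrite square_swap square_side // subr_le0.
Qed.

(** By clamping, the line (x, x - 1) runs along the bottom side up to time 1 and then up the far
    side. *)
Lemma square_walk v s t (h : square_dart gen (v, s, t)) x :
  square h x (x - 1) = lazy_walk v [:: Some s; Some t] x.
Proof.
rewrite /=; case: (lerP x 1) => x1; first by rewrite square_side // subr_le0.
rewrite (square_far_side _ _ (ltW x1)); case: (lerP (x - 1) 1) => x2 //.
by rewrite edge_ge1 // ltW.
Qed.

Lemma lazy_swap s t q : s != t -> (gen s * gen t = gen t * gen s)%g ->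
  lazy_homotopic [:: Some s, Some t & q] [:: Some t, Some s & q].
Proof.
move=> st c; have h v : square_dart gen (v, s, t) by rewrite /= st c eqxx.
(* The line moves from (x, x - 1) to (x - 1, x). At x = 0 both coordinates are at most 0 and at x =
   2 at least 1, so the end points remain at opposite corners. *)
apply: (@lazy_homotopic_block _ _ _ _ _
  (fun v p => square (h v) (p.1 - val01 p.2) (p.1 - 1 + val01 p.2))) => //.
- move=> v; apply: (@continuous_compose _ _ _
    (fun p : R * I01 R => (p.1 - val01 p.2, p.1 - 1 + val01 p.2))
    (fun q => square (h v) q.1 q.2)); last exact: square_continuous.
  have c2 : continuous (fun p : R * I01 R => val01 p.2).
    exact: continuous_compose (@continuous_snd _ _) (@val01_continuous R).
  apply: continuous_pair.
    by apply: continuous_subr => //; exact: continuous_fst.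
  apply: continuous_addr => //.
  by apply: continuous_subr; [exact: continuous_fst|exact: continuous_cst].
- by move=> v x; rewrite /= val_clamp01_0 subr0 addr0 square_walk.
- by move=> v x; rewrite /= val_clamp01_1 subrK square_swap square_walk.
- move=> v u /=; have := val01_ge0 u; have := val01_le1 u => u1 u0.
  by rewrite square_side ?edge_le0 //; lra.
- move=> v u /=; have := val01_ge0 u; have := val01_le1 u => u1 u0.
  by rewrite square_far_side ?edge_ge1 //; lra.
Qed.

(** * Padding words to a common length *)

Definition pad (n : nat) (w : seq S) : seq (option S) :=
  map Some w ++ nseq (n - size w) None.

Lemma lazy_homotopic_catl p w w' :
  lazy_homotopic w w' -> lazy_homotopic (p ++ w) (p ++ w').
Proof. by move=> h; elim: p => //= o p; exact: lazy_homotopic_cons. Qed.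

Lemma lazy_delay w q :
  lazy_homotopic (None :: map Some w ++ q) (map Some w ++ None :: q).
Proof.
elim: w => [|s w IH] /=; first exact: lazy_homotopic_refl.
apply: lazy_homotopic_trans (lazy_wait _ _) _.
exact: lazy_homotopic_cons.
Qed.

(** A cancellation leaves two waits in place of the letters; [lazy_delay] carries each of them to
    the end. *)
Lemma elementary_move_pad w w' n : elementary_move gen w w' ->
  (size w <= n)%N -> lazy_homotopic (pad n w) (pad n w').
Proof.
case=> [p s q|p s t q st c]; rewrite /pad !map_cat !size_cat /= => wn;
  rewrite -!catA; apply: lazy_homotopic_catl; last first.
  exact: lazy_swap.
apply: lazy_homotopic_trans (lazy_cancel _ _) _.
rewrite (_ : n - (size p + size q) = (n - (size p + (size q).+2)).+2)%N; last by lia.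
apply: lazy_homotopic_trans (lazy_homotopic_cons _ (lazy_delay _ _)) _.
exact: lazy_delay.
Qed.

(** The words in between may be longer than both ends, hence the bound [n0]. *)
Lemma move_eq_pad w w' : move_eq gen w w' ->
  exists n0, forall n, (n0 <= n)%N -> lazy_homotopic (pad n w) (pad n w').
Proof.
elim=> {w w'} [w w' h|w|w w' _ [n0 IH]|w1 w2 w3 _ [n1 IH1] _ [n2 IH2]].
- by exists (size w) => n; exact: elementary_move_pad.
- by exists 0%N => n _; exact: lazy_homotopic_refl.
- by exists n0 => n /IH; exact: lazy_homotopic_sym.
- exists (maxn n1 n2) => n; rewrite geq_max => /andP[/IH1 h1 /IH2 h2].
  exact: lazy_homotopic_trans h1 h2.
Qed.

Lemma walk_pad v w k x :
  walk gen v w x = lazy_walk v (map Some w ++ nseq k None) x.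
Proof.
elim: w v x => [|s w IH] v x /=; last by rewrite IH.
elim: k x => //= k IH x; case: ifP => // _; by rewrite mulg1 -IH.
Qed.

Lemma lazy_val_pad w k : lazy_val (map Some w ++ nseq k None) = word_val gen w.
Proof.
rewrite /lazy_val big_cat big_map /= [X in (_ * X)%g]big1_seq ?mulg1 //.
by move=> o /andP[_]; rewrite mem_nseq => /andP[_ /eqP->].
Qed.

Lemma move_eq_null_homotopic w : word_val gen w = 1%g -> move_eq gen w [::] ->
  null_homotopic (@word_path R W S gen w).
Proof.
move=> w1 /move_eq_pad[n0 h0].
pose n := (n0 + size w)%N; have [sw h] := h0 n (leq_addr _ _).
have [H [cH H0 H1 Ha Hb]] := h 1%g.
have szn : size (pad n w) = n by rewrite size_cat size_map size_nseq /n; lia.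
have sz : (size w)%:R <= n%:R :> R by rewrite ler_nat leq_addl.
have c2 : continuous (fun p : I01 R * I01 R => 2 * val01 p.2).
  apply: continuous_mulr; first exact: continuous_cst.
  exact: continuous_compose (@continuous_snd _ _) (@val01_continuous R).
(* For [t <= 1/2] the loop is reparametrized from length [size w] to [n]. *)
exists (fun p => H (val01 p.1 * ((size w)%:R + (n%:R - (size w)%:R) *
    Num.min 1 (2 * val01 p.2)), clamp01 (2 * val01 p.2 - 1))), (vertex 1%g); split.
- apply: continuous_compose cH; apply: continuous_pair; last first.
    apply: continuous_compose (@clamp01_continuous R).
    by apply: continuous_subr => //; exact: continuous_cst.
  apply: continuous_mulr.
    exact: continuous_compose (@continuous_fst _ _) (@val01_continuous R).
  apply: continuous_addr; first exact: continuous_cst.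
  apply: continuous_mulr; first exact: continuous_cst.
  by apply: continuous_minr => //; exact: continuous_cst.
- move=> x /=; rewrite val_clamp01_0 mulr0 (min_r ler01) mulr0 addr0 sub0r.
  by rewrite clamp01_le0 ?lerN10 // H0 /word_path (walk_pad _ _ (n - size w)).
- move=> x /=; rewrite val_clamp01_1 mulr1 clamp01_ge1; last by lra.
  by rewrite H1 -walk_pad.
- move=> t /=; rewrite val_clamp01_0 val_clamp01_1 mul0r Ha mul1r.
  have [t1|t1] := lerP (2 * val01 t) 1; last first.
    by rewrite mulr1 addrC subrK -szn Hb lazy_val_pad w1 mulg1.
  (* The end time is at least [size w], where the padded walk already waits at its last vertex. *)
  rewrite clamp01_le0 ?subr_le0 // H0 -walk_pad (walk_pad _ _ 0) lazy_walk_ge.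
    by rewrite lazy_val_pad w1 mulg1.
  rewrite cats0 size_map lerDl mulr_ge0 ?subr_ge0 //.
  by have := val01_ge0 t; lra.
Qed.
End Paths.

(** * From the girth to bounds on the exponents *)

Lemma omin_big_le (I : eqType) (r : seq I) (P : pred I) (F : I -> option nat) i x :
  i \in r -> P i -> F i = Some x ->
  exists2 y, \big[omin/None]_(j <- r | P j) F j = Some y & (y <= x)%N.
Proof.
elim: r => // j r IH + Pi Fi; rewrite inE big_cons => /predU1P[<-|ir].
  rewrite Pi Fi; case: (\big[_/_]_(_ <- _ | _) _) => [y|] /=; last by exists x.
  by exists (minn x y); rewrite ?geq_minl.
have [y -> yx] := IH ir Pi Fi; case: ifP => _; last by exists y.
case: (F j) => [z|] /=; last by exists y.
by exists (minn z y) => //; apply: leq_trans (geq_minr _ _) yx.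
Qed.

Lemma girth_below (S : finType) (m : S -> S -> option nat) (I : {set S}) n :
  lt_onat n (girth m I) -> below_girth m I n.
Proof.
rewrite /girth => h b c k bI cI bc mE.
have [y yE yk] : exists2 y, \big[omin/None]_(t in I | t != b) m b t = Some y & (y <= k)%N.
  by apply: (omin_big_le (i := c)) => //; rewrite ?mem_index_enum // cI eq_sym bc.
have [z zE zy] := omin_big_le (P := fun s => s \in I)
  (F := fun s => \big[omin/None]_(t in I | t != s) m s t)
  (mem_index_enum b) bI yE.
by move: h; rewrite zE /=; lia.
Qed.

Theorem theorem9 (R : realType) (W : groupType) (S : finType) (gen : S -> W)
    (m : S -> S -> option nat) (SR SB : {set S}) (w : seq S) :
  coxeter_system gen m ->
  right_angled_partition m SR SB ->
  cyclic_loop gen w ->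
  lt_onat (letters_in SR w) (girth m SR) ->
  lt_onat (letters_in SB w) (girth m SB) ->
  null_homotopic (@word_path R W S gen w).
Proof.
move=> cs ra [_ w1] /girth_below shR /girth_below shB.
have mw := short_loop_moves cs ra w1 shR shB.
exact: (@move_eq_null_homotopic R W S gen (gen_sq cs) w w1 mw).
Qed.
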